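(* Let $\varphi\in A(\mathbb{D})$ with $\varphi(\mathbb{D})\subset\mathbb{D}$, and let $u\in A(\mathbb{D})$ with $u\not\equiv 0$. Then the weighted composition operator $uC_\varphi$ is a Daugavet center in $A(\mathbb{D})$ if and only if $\varphi$ is an inner function and $u$ is a multiple of an inner function.
   Context: $\mathbb{D}=\{z\in\mathbb{C}: |z|<1\}$, $\mathbb{T}=\{z\in\mathbb{C}:|z|=1\}$. The disk algebra $A(\mathbb{D})$ is the Banach space of holomorphic functions on $\mathbb{D}$ that extend continuously to $\overline{\mathbb{D}}$, with norm $\|f\|_\infty=\sup_{z\in\mathbb{D}}|f(z)|$. The operator $uC_\varphi:A(\mathbb{D})\to A(\mathbb{D})$ is $uC_\varphi(f)=u\cdot(f\circ\varphi)$. A function $h\in A(\mathbb{D})$ is inner if $|h|=1$ on $\mathbb{T}$; ''multiple'' means multiple by a complex scalar. A bounded linear operator $G:X\to X$ on a Banach space $X$ is a Daugavet center if $\|G+T\|=\|G\|+\|T\|$ for every rank-$1$ bounded linear operator $T:X\to X$. *)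

(* Defs.v *)
From Stdlib Require Import Reals Lra ProofIrrelevance FunctionalExtensionality.
From Stdlib Require Import ClassicalEpsilon.
From Coquelicot Require Import Coquelicot.
Open Scope R_scope.

Definition op_norm {K : AbsRing} {X Y : NormedModule K} (T : X -> Y) : R :=
  real (Lub_Rbar (fun r => exists x : X, norm x <= 1 /\ r = norm (T x))).

(* The boundedness of [T] is part of Coquelicot's [is_linear]. *)
Definition rank_one {K : AbsRing} {X Y : NormedModule K} (T : X -> Y) : Prop :=
  is_linear T /\
  exists y : Y, y <> zero /\
    forall v : Y, (exists x : X, T x = v) <-> (exists c : K, v = scal c y).

Definition Daugavet_center {K : AbsRing} {X : NormedModule K} (G : X -> X) : Prop :=
  is_linear G /\
  forall T : X -> X, rank_one T ->
    op_norm (fun x => plus (G x) (T x)) = op_norm G + op_norm T.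

Definition open_disc (z : C) : Prop := Cmod z < 1.
Definition closed_disc (z : C) : Prop := Cmod z <= 1.
Definition unit_circle (z : C) : Prop := Cmod z = 1.

(* A function in the disc algebra, together with its continuous extension to
   the closed disc, is represented by a total function on [C].  The value 0
   outside the closed disc makes this representation unique.  The derivative
   is the complex one, because the domain of [f] is [C_AbsRing]. *)
Definition in_disc_algebra (f : C -> C) : Prop :=
  (forall z, open_disc z -> ex_derive f z) /\
  continuous_on closed_disc f /\
  (forall z, ~ closed_disc z -> f z = 0%C).

Record disc_algebra := Disc_algebra {
  da_fun :> C -> C;
  da_in : in_disc_algebra da_fun }.

Definition sup_norm (f : disc_algebra) : R :=
  real (Lub_Rbar (fun r => exists z, open_disc z /\ r = Cmod (f z))).

Lemma da_eq (f g : disc_algebra) : (forall z, f z = g z) -> f = g.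
Proof.
destruct f as [f Hf], g as [g Hg]; simpl; intros H.
assert (E : f = g) by (apply functional_extensionality; exact H).
subst g; f_equal; apply proof_irrelevance.
Qed.

Lemma Cmod_minus_sym (x y : C) : Cmod (x - y) = Cmod (y - x).
Proof. rewrite <- (Cmod_opp (x - y)); f_equal; ring. Qed.

Lemma continuous_on_C (D : C -> Prop) (f : C -> C) :
  continuous_on D f <->
  forall z, D z -> forall eps, 0 < eps -> exists d, 0 < d /\
    forall w, D w -> Cmod (w - z) < d -> Cmod (f w - f z) < eps.
Proof.
split; intros H z Dz.
- intros eps He.
  set (e := mkposreal eps He).
  assert (Hl : @locally C_UniformSpace (f z) (fun y : C => Cmod (y - f z) < eps)).
  { apply (locally_le_locally_norm (V := C_NormedModule)).
    exists e; intros y Hy; exact Hy. }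
  destruct (locally_norm_le_locally (V := C_NormedModule) z _ (H z Dz _ Hl)) as [d Hd].
  exists d; split; [apply cond_pos|].
  intros w Dw Hw; exact (Hd w Hw Dw).
- intros P HP.
  destruct (locally_norm_le_locally (V := C_NormedModule) (f z) P HP) as [e He].
  destruct (H z Dz e (cond_pos e)) as [d [d0 Hd]].
  apply (locally_le_locally_norm (V := C_NormedModule)).
  exists (mkposreal d d0); intros w Hw Dw.
  apply He; exact (Hd w Dw Hw).
Qed.

Lemma ex_derive_C (f : C -> C) (z : C) :
  ex_derive (V := C_NormedModule) f z <->
  ex_derive (V := AbsRing_NormedModule C_AbsRing) f z.
Proof.
split; intros [l [[L1 L2 L3] H]]; exists l; (split; [split; assumption|exact H]).
Qed.

Lemma ex_derive_C_mult (f g : C -> C) (z : C) :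
  ex_derive f z -> ex_derive g z -> ex_derive (fun w => (f w * g w)%C) z.
Proof.
intros Hf Hg.
apply ex_derive_C in Hf; apply ex_derive_C in Hg; apply ex_derive_C.
destruct Hf as [df Hf], Hg as [dg Hg].
eexists; apply (is_derive_mult (K := C_AbsRing) f g z df dg Hf Hg).
intros; apply Cmult_comm.
Qed.

Lemma ex_derive_C_comp (f g : C -> C) (z : C) :
  ex_derive f (g z) -> ex_derive g z -> ex_derive (fun w => f (g w)) z.
Proof.
intros Hf Hg; apply ex_derive_C in Hg.
exact (ex_derive_comp (K := C_AbsRing) (V := C_NormedModule) f g z Hf Hg).
Qed.

Lemma continuous_on_Cplus (D : C -> Prop) (f g : C -> C) :
  continuous_on D f -> continuous_on D g ->
  continuous_on D (fun z => (f z + g z)%C).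
Proof.
rewrite !continuous_on_C; intros Hf Hg z Dz eps He.
destruct (Hf z Dz (eps / 2) ltac:(lra)) as [d [d0 Hd]].
destruct (Hg z Dz (eps / 2) ltac:(lra)) as [d' [d0' Hd']].
exists (Rmin d d'); split; [apply Rmin_pos; assumption|].
intros w Dw Hw.
assert (H1 := Hd w Dw (Rlt_le_trans _ _ _ Hw (Rmin_l _ _))).
assert (H2 := Hd' w Dw (Rlt_le_trans _ _ _ Hw (Rmin_r _ _))).
replace (f w + g w - (f z + g z))%C with ((f w - f z) + (g w - g z))%C by ring.
assert (H3 := Cmod_triangle (f w - f z) (g w - g z)); lra.
Qed.

Lemma continuous_on_Cmult (D : C -> Prop) (f g : C -> C) :
  continuous_on D f -> continuous_on D g ->
  continuous_on D (fun z => (f z * g z)%C).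
Proof.
intros Hf Hg z Dz.
apply (filterlim_comp_2 (G := @locally C_UniformSpace (f z))
         (H := @locally C_UniformSpace (g z)) f g Cmult).
- exact (Hf z Dz).
- exact (Hg z Dz).
- intros P HP.
  apply (locally_C (f z * g z)%C) in HP.
  destruct (filterlim_mult (K := C_AbsRing) (f z) (g z) P HP) as [Q R HQ HR HQR].
  exists Q R; [apply locally_C; exact HQ|apply locally_C; exact HR|exact HQR].
Qed.

Lemma continuous_on_Ccomp (D E : C -> Prop) (f g : C -> C) :
  (forall z, D z -> E (g z)) ->
  continuous_on E f -> continuous_on D g ->
  continuous_on D (fun z => f (g z)).
Proof.
rewrite !continuous_on_C; intros HDE Hf Hg z Dz eps He.
destruct (Hf (g z) (HDE z Dz) eps He) as [d [d0 Hd]].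
destruct (Hg z Dz d d0) as [d' [d0' Hd']].
exists d'; split; [assumption|]; intros w Dw Hw.
apply Hd; auto.
Qed.

Lemma in_da_const0 : in_disc_algebra (fun _ => 0%C).
Proof.
split; [|split].
- intros z _; apply ex_derive_const.
- intros z _; apply filterlim_const.
- reflexivity.
Qed.

Lemma in_da_plus (f g : disc_algebra) : in_disc_algebra (fun z => (f z + g z)%C).
Proof.
destruct f as [f [F1 [F2 F3]]], g as [g [G1 [G2 G3]]]; simpl.
split; [|split].
- intros z Hz.
  exact (ex_derive_plus (K := C_AbsRing) (V := C_NormedModule) f g z (F1 z Hz) (G1 z Hz)).
- apply continuous_on_Cplus; assumption.
- intros z Hz; rewrite F3, G3 by assumption; ring.
Qed.

Lemma in_da_scal (c : C) (f : disc_algebra) : in_disc_algebra (fun z => (c * f z)%C).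
Proof.
destruct f as [f [F1 [F2 F3]]]; simpl.
split; [|split].
- intros z Hz; apply ex_derive_C_mult; [apply ex_derive_const|auto].
- apply continuous_on_Cmult; [|assumption].
  intros z _; apply filterlim_const.
- intros z Hz; rewrite F3 by assumption; ring.
Qed.

Lemma in_da_opp (f : disc_algebra) : in_disc_algebra (fun z => (- f z)%C).
Proof.
replace (fun z => (- f z)%C) with (fun z => (- (1) * f z)%C).
- apply in_da_scal.
- apply functional_extensionality; intros z; ring.
Qed.

Definition da_zero : disc_algebra := Disc_algebra _ in_da_const0.
Definition da_plus (f g : disc_algebra) : disc_algebra := Disc_algebra _ (in_da_plus f g).
Definition da_opp (f : disc_algebra) : disc_algebra := Disc_algebra _ (in_da_opp f).
Definition da_scal (c : C) (f : disc_algebra) : disc_algebra :=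
  Disc_algebra _ (in_da_scal c f).

Lemma da_plus_comm f g : da_plus f g = da_plus g f.
Proof. apply da_eq; intros z; simpl; ring. Qed.
Lemma da_plus_assoc f g h : da_plus f (da_plus g h) = da_plus (da_plus f g) h.
Proof. apply da_eq; intros z; simpl; ring. Qed.
Lemma da_plus_zero_r f : da_plus f da_zero = f.
Proof. apply da_eq; intros z; simpl; ring. Qed.
Lemma da_plus_opp_r f : da_plus f (da_opp f) = da_zero.
Proof. apply da_eq; intros z; simpl; ring. Qed.

Definition da_AbelianMonoid_mixin :=
  AbelianMonoid.Mixin disc_algebra da_plus da_zero
    da_plus_comm da_plus_assoc da_plus_zero_r.
Canonical da_AbelianMonoid :=
  AbelianMonoid.Pack disc_algebra da_AbelianMonoid_mixin disc_algebra.
Definition da_AbelianGroup_mixin :=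
  AbelianGroup.Mixin da_AbelianMonoid da_opp da_plus_opp_r.
Canonical da_AbelianGroup :=
  AbelianGroup.Pack disc_algebra
    (AbelianGroup.Class _ _ da_AbelianGroup_mixin) disc_algebra.

Lemma da_scal_assoc (x y : C_Ring) (f : da_AbelianGroup) :
  da_scal x (da_scal y f) = da_scal (mult x y) f.
Proof. apply da_eq; intros z; apply Cmult_assoc. Qed.
Lemma da_scal_one (f : da_AbelianGroup) : da_scal (@one C_Ring) f = f.
Proof. apply da_eq; intros z; apply Cmult_1_l. Qed.
Lemma da_scal_distr_l (x : C_Ring) (f g : da_AbelianGroup) :
  da_scal x (plus f g) = plus (da_scal x f) (da_scal x g).
Proof. apply da_eq; intros z; apply Cmult_plus_distr_l. Qed.
Lemma da_scal_distr_r (x y : C_Ring) (f : da_AbelianGroup) :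
  da_scal (plus x y) f = plus (da_scal x f) (da_scal y f).
Proof. apply da_eq; intros z; apply Cmult_plus_distr_r. Qed.

Definition da_ModuleSpace_mixin :=
  ModuleSpace.Mixin C_Ring da_AbelianGroup da_scal
    da_scal_assoc da_scal_one da_scal_distr_l da_scal_distr_r.
Canonical da_ModuleSpace :=
  ModuleSpace.Pack C_Ring disc_algebra
    (ModuleSpace.Class _ _ _ da_ModuleSpace_mixin) disc_algebra.

Lemma da_bounded (f : disc_algebra) :
  exists M, forall z, closed_disc z -> Cmod (f z) <= M.
Proof.
destruct (da_in f) as [_ [Hc _]].
rewrite continuous_on_C in Hc.
assert (Hd : forall p : C, exists d : posreal,
   forall w, closed_disc w -> Rabs (fst w - fst p) < d -> Rabs (snd w - snd p) < d ->
     Cmod (f w) <= / d).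
{ intros p.
  destruct (excluded_middle_informative (closed_disc p)) as [Hp|Hp].
  - destruct (Hc p Hp 1 Rlt_0_1) as [d [d0 Hd]].
    set (B := Cmod (f p) + 1).
    assert (HB : 0 < B) by (unfold B; generalize (Cmod_ge_0 (f p)); lra).
    assert (Hm : 0 < Rmin (d / 2) (/ B)).
    { apply Rmin_pos; [lra|apply Rinv_0_lt_compat; assumption]. }
    exists (mkposreal _ Hm); simpl; intros w Hw H1 H2.
    apply Rle_trans with B.
    + assert (H3 : Cmod (w - p) < d).
      { apply Rle_lt_trans with (1 := Cmod_2Rmax _); simpl.
        assert (H4 : Rmax (Rabs (fst w - fst p)) (Rabs (snd w - snd p)) < d / 2).
        { apply Rmax_lub_lt; eapply Rlt_le_trans; try eassumption; apply Rmin_l. }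
        assert (H5 : sqrt 2 <= 2).
        { rewrite <- (sqrt_square 2) at 2 by lra; apply sqrt_le_1; lra. }
        assert (H6 := sqrt_pos 2).
        assert (H7 := Rle_trans _ _ _ (Rabs_pos (fst w - fst p)) (Rmax_l _ (Rabs (snd w - snd p)))).
        unfold Rminus in *; nra. }
      specialize (Hd w Hw H3); unfold B.
      assert (H4 := Cmod_triangle (f w - f p) (f p)).
      replace (f w - f p + f p)%C with (f w) in H4 by ring; lra.
    + rewrite <- (Rinv_inv B) at 1.
      apply Rinv_le_contravar; [exact Hm|apply Rmin_r].
  - assert (H1 : 0 < (Cmod p - 1) / 2).
    { apply Rnot_le_lt in Hp; lra. }
    exists (mkposreal _ H1); simpl; intros w Hw H2 H3; exfalso.
    apply Rnot_le_lt in Hp; unfold closed_disc in Hw.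
    assert (H4 := Cmod_triangle w (p - w)).
    replace (w + (p - w))%C with p in H4 by ring.
    rewrite Cmod_minus_sym in H4.
    assert (H5 := Cmod_2Rmax (w - p)); simpl in H5.
    assert (H6 : Rmax (Rabs (fst w - fst p)) (Rabs (snd w - snd p)) < (Cmod p - 1) / 2)
      by (apply Rmax_lub_lt; assumption).
    assert (H7 : sqrt 2 <= 2).
    { rewrite <- (sqrt_square 2) at 2 by lra; apply sqrt_le_1; lra. }
    assert (H8 := Rle_trans _ _ _ (Rabs_pos (fst w - fst p)) (Rmax_l _ (Rabs (snd w - snd p)))).
    unfold Rminus in *; nra. }
set (delta := fun x y => proj1_sig (constructive_indefinite_description _ (Hd (x, y)))).
assert (Hdelta : forall x y w, closed_disc w ->
   Rabs (fst w - x) < delta x y -> Rabs (snd w - y) < delta x y ->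
     Cmod (f w) <= / delta x y).
{ intros x y; unfold delta; destruct constructive_indefinite_description as [d H]; exact H. }
destruct (compactness_value_2d (-1) 1 (-1) 1 delta) as [d Hcomp].
exists (/ d); intros w Hw.
apply Rnot_lt_le; intros Hlt.
assert (H0 := Rle_trans _ _ _ (Rmax_Cmod w) Hw).
assert (H1 := Rle_trans _ _ _ (Rmax_l _ _) H0).
assert (H2 := Rle_trans _ _ _ (Rmax_r _ _) H0).
apply Rabs_le_between in H1; apply Rabs_le_between in H2.
apply (Hcomp (fst w) (snd w) H1 H2); intros [x [y [_ [_ [K1 [K2 K3]]]]]].
assert (K4 := Hdelta x y w Hw K1 K2).
assert (K5 := Rinv_le_contravar _ _ (cond_pos d) K3); lra.
Qed.

Lemma sup_norm_lub (f : disc_algebra) :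
  is_lub_Rbar (fun r => exists z, open_disc z /\ r = Cmod (f z)) (Finite (sup_norm f)).
Proof.
unfold sup_norm.
destruct (da_bounded f) as [M HM].
assert (H := Lub_Rbar_correct (fun r => exists z, open_disc z /\ r = Cmod (f z))).
destruct (Lub_Rbar _) as [l| |]; [exact H| |]; destruct H as [H1 H2]; exfalso.
- apply (H2 (Finite M)); intros r [z [Hz ->]]; apply HM; left; exact Hz.
- apply (H1 (Cmod (f 0%C))); exists 0%C; split; [|reflexivity].
  unfold open_disc; rewrite Cmod_0; lra.
Qed.

Lemma le_sup_norm (f : disc_algebra) (z : C) : open_disc z -> Cmod (f z) <= sup_norm f.
Proof. intros Hz; apply (sup_norm_lub f); exists z; auto. Qed.

Lemma sup_norm_le (f : disc_algebra) (M : R) :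
  (forall z, open_disc z -> Cmod (f z) <= M) -> sup_norm f <= M.
Proof.
intros H; apply (proj2 (sup_norm_lub f) (Finite M)).
intros r [z [Hz ->]]; apply H; exact Hz.
Qed.

Lemma closed_disc_approx (z : C) (d : R) : closed_disc z -> 0 < d ->
  exists w, open_disc w /\ Cmod (w - z) < d.
Proof.
intros Hz Hd.
set (t := Rmin (d / 2) (1 / 2)).
assert (t0 : 0 < t) by (apply Rmin_pos; lra).
assert (t1 : t <= d / 2) by apply Rmin_l.
assert (t2 : t <= 1 / 2) by apply Rmin_r.
unfold closed_disc in Hz; assert (H0 := Cmod_ge_0 z).
exists (RtoC (1 - t) * z)%C; split.
- unfold open_disc; rewrite Cmod_mult, Cmod_R, Rabs_pos_eq by lra; nra.
- replace (RtoC (1 - t) * z - z)%C with (RtoC (- t) * z)%C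
    by (rewrite RtoC_minus, RtoC_opp; ring).
  rewrite Cmod_mult, Cmod_R, Rabs_Ropp, Rabs_pos_eq by lra; nra.
Qed.

Lemma da_closed_bound (f : disc_algebra) (M : R) :
  (forall z, open_disc z -> Cmod (f z) <= M) ->
  forall z, closed_disc z -> Cmod (f z) <= M.
Proof.
destruct (da_in f) as [_ [Hc _]]; rewrite continuous_on_C in Hc.
intros H z Hz; apply Rnot_lt_le; intros Hlt.
destruct (Hc z Hz (Cmod (f z) - M) ltac:(lra)) as [d [d0 Hd]].
destruct (closed_disc_approx z d Hz d0) as [w [Hw Hwz]].
assert (H1 := Hd w (Rlt_le _ _ Hw) Hwz); assert (H2 := H w Hw).
assert (H3 := Cmod_triangle (f z - f w) (f w)).
replace (f z - f w + f w)%C with (f z) in H3 by ring.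
rewrite Cmod_minus_sym in H3; lra.
Qed.

Lemma sup_norm_triangle (f g : disc_algebra) :
  sup_norm (plus f g) <= sup_norm f + sup_norm g.
Proof.
apply sup_norm_le; intros z Hz.
apply Rle_trans with (1 := Cmod_triangle _ _).
apply Rplus_le_compat; apply le_sup_norm; exact Hz.
Qed.

Lemma sup_norm_scal (c : C_AbsRing) (f : da_ModuleSpace) :
  sup_norm (scal c f) <= abs c * sup_norm f.
Proof.
apply sup_norm_le; intros z Hz.
change (Cmod (c * f z) <= Cmod c * sup_norm f).
rewrite Cmod_mult; apply Rmult_le_compat_l; [apply Cmod_ge_0|].
apply le_sup_norm; exact Hz.
Qed.

Lemma sup_norm_eq0 (f : disc_algebra) : sup_norm f = 0 -> f = zero.
Proof.
intros H; apply da_eq; intros z; change (f z = 0%C).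
destruct (Rle_or_lt (Cmod z) 1) as [Hz|Hz].
- apply Cmod_eq_0, Rle_antisym; [|apply Cmod_ge_0].
  apply (da_closed_bound f); [|exact Hz].
  intros w Hw; rewrite <- H; apply le_sup_norm; exact Hw.
- destruct (da_in f) as [_ [_ F3]]; apply F3, Rlt_not_le; exact Hz.
Qed.

Definition da_ball (f : disc_algebra) (e : R) (g : disc_algebra) : Prop :=
  sup_norm (minus g f) < e.

Lemma da_ball_center (f : disc_algebra) (e : posreal) : da_ball f e f.
Proof.
unfold da_ball; rewrite minus_eq_zero.
apply Rle_lt_trans with 0; [|apply cond_pos].
apply sup_norm_le; intros z _; change (Cmod 0 <= 0); rewrite Cmod_0; lra.
Qed.

Lemma da_ball_sym (f g : disc_algebra) (e : R) : da_ball f e g -> da_ball g e f.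
Proof.
unfold da_ball; apply Rle_lt_trans, sup_norm_le; intros z Hz.
change (Cmod (f z - g z) <= sup_norm (minus g f)); rewrite Cmod_minus_sym.
exact (le_sup_norm (minus g f) z Hz).
Qed.

Lemma da_ball_triangle (f g h : disc_algebra) (e1 e2 : R) :
  da_ball f e1 g -> da_ball g e2 h -> da_ball f (e1 + e2) h.
Proof.
unfold da_ball; intros H1 H2.
replace (minus h f) with (plus (minus h g) (minus g f)).
- apply Rle_lt_trans with (1 := sup_norm_triangle (minus h g) (minus g f)).
  rewrite (Rplus_comm e1); exact (Rplus_lt_compat _ _ _ _ H2 H1).
- symmetry; apply minus_trans.
Qed.

Definition da_UniformSpace_mixin :=
  UniformSpace.Mixin disc_algebra da_zero da_ball
    da_ball_center da_ball_sym da_ball_triangle.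
Canonical da_UniformSpace :=
  UniformSpace.Pack disc_algebra da_UniformSpace_mixin disc_algebra.

Canonical da_NormedModuleAux :=
  NormedModuleAux.Pack C_AbsRing disc_algebra
    (NormedModuleAux.Class C_AbsRing disc_algebra
       (ModuleSpace.class _ da_ModuleSpace) da_UniformSpace_mixin) disc_algebra.

Lemma da_norm_ball1 (f g : da_NormedModuleAux) (e : R) :
  sup_norm (minus g f) < e -> ball f e g.
Proof. intros H; exact H. Qed.

Lemma da_norm_ball2 (f g : da_NormedModuleAux) (e : posreal) :
  ball f e g -> sup_norm (minus g f) < 1 * e.
Proof. intros H; rewrite Rmult_1_l; exact H. Qed.

Definition da_NormedModule_mixin :=
  NormedModule.Mixin C_AbsRing da_NormedModuleAux sup_norm 1
    sup_norm_triangle sup_norm_scal da_norm_ball1 da_norm_ball2 sup_norm_eq0.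
Canonical da_NormedModule :=
  NormedModule.Pack C_AbsRing disc_algebra
    (NormedModule.Class C_AbsRing disc_algebra _ da_NormedModule_mixin) disc_algebra.

Definition disc_self_map (phi : disc_algebra) : Prop :=
  forall z, open_disc z -> open_disc (phi z).

Lemma in_da_weighted_comp (u phi : disc_algebra) (Hphi : disc_self_map phi)
  (f : disc_algebra) : in_disc_algebra (fun z => (u z * f (phi z))%C).
Proof.
assert (Hcl : forall z, closed_disc z -> closed_disc (phi z)).
{ apply (da_closed_bound phi 1); intros z Hz; left; exact (Hphi z Hz). }
destruct u as [u [U1 [U2 U3]]], f as [f [F1 [F2 F3]]], phi as [phi [P1 [P2 P3]]].
unfold disc_self_map in Hphi; simpl in *.
split; [|split].
- intros z Hz; apply ex_derive_C_mult; [auto|].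
  apply ex_derive_C_comp; auto.
- apply continuous_on_Cmult; [assumption|].
  apply (continuous_on_Ccomp _ closed_disc); assumption.
- intros z Hz; rewrite U3 by assumption; ring.
Qed.

Definition weighted_comp (u phi : disc_algebra) (Hphi : disc_self_map phi)
  (f : disc_algebra) : disc_algebra :=
  Disc_algebra (fun z => (u z * f (phi z))%C) (in_da_weighted_comp u phi Hphi f).

Definition inner (h : disc_algebra) : Prop :=
  forall z, unit_circle z -> Cmod (h z) = 1.

(* Main.v *)
Require Import Defs.
From Stdlib Require Import Reals.
From Coquelicot Require Import Coquelicot.
From Stdlib Require Import Lra List Classical ClassicalEpsilon FunctionalExtensionality.

(** The only complex analysis needed is the maximum modulus principle on the
    disc.  It follows from the mean value property at 0 and Moebius maps, and the
    mean value property is Goursat's theorem in logarithmic coordinates [s + i t]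
    on [a, b] x [0, 2 pi], where the horizontal sides cancel by periodicity.

    Necessity.  Test the Daugavet equation on [f |-> kappa f(w0) y] with [y] peaking
    at a boundary point [z0]: near-extremal functions are detected near [z0].
    This forces [|u(z0)| = ||u||].  If [w0 = phi z0] were inside the disc, then for
    [kappa = - u z0] the two terms would nearly cancel, because the unit ball is
    equicontinuous at [w0].

    Sufficiency.  Let [T f = xi(f) y] and let [f] nearly attain [||T||], so that
    [|T f|] is nearly [||T||] on a set [V] of boundary points.  The maximum principle
    shows that [phi] takes infinitely many values on [V].  For [z] in [V] a bump [h]
    peaking at [phi z] gives [f + h] of norm nearly 1 with any prescribed unimodular
    value at [phi z].  Bumps with separated peaks have uniformly bounded unimodular
    combinations, so [xi] is small on some of them; for that [z] the terms
    [u f(phi)] and [T f] can be aligned at [z]. *)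

(** * Goursat for the Cauchy-Riemann equations *)

(** Disposes of the accumulated errors at the end of an estimate. The sign of [c] is free, so the
    test value of [eps] is scaled by [Rabs c + 1]. *)
Lemma le_of_le_plus_eps (a b c : R) :
  (forall eps, 0 < eps -> a <= b + eps * c) -> a <= b.
Proof.
intros H; apply Rnot_lt_le; intros Hlt.
assert (Hc : 0 < Rabs c + 1) by (generalize (Rabs_pos c); lra).
assert (He : 0 < (a - b) / (Rabs c + 1)) by (apply Rdiv_lt_0_compat; lra).
specialize (H ((a - b) / (Rabs c + 1) / 2) ltac:(lra)).
assert (H1 := Rle_abs c).
assert (H2 : (a - b) / (Rabs c + 1) / 2 * c <= (a - b) / (Rabs c + 1) / 2 * (Rabs c + 1)).
{ apply Rmult_le_compat_l; lra. }
replace ((a - b) / (Rabs c + 1) / 2 * (Rabs c + 1)) with ((a - b) / 2) in H2 by (field; lra).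
lra.
Qed.

(** The supremum of the left ends works, since every left end lies below every right end. *)
Lemma nested_intervals (a b : nat -> R) :
  (forall n, a n <= a (S n)) -> (forall n, b (S n) <= b n) ->
  (forall n, a n <= b n) ->
  exists x, forall n, a n <= x <= b n.
Proof.
intros Ha Hb Hab.
assert (Ha' : forall n k, a n <= a (n + k)%nat).
{ intros n k; induction k; [rewrite Nat.add_0_r; lra|].
  rewrite Nat.add_succ_r; generalize (Ha (n + k)%nat); lra. }
assert (Hb' : forall n k, b (n + k)%nat <= b n).
{ intros n k; induction k; [rewrite Nat.add_0_r; lra|].
  rewrite Nat.add_succ_r; generalize (Hb (n + k)%nat); lra. }
assert (H : forall m n, a m <= b n).
{ intros m n; generalize (Ha' m n) (Hb' n m) (Hab (m + n)%nat).
  rewrite (Nat.add_comm n m); lra. }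
destruct (completeness (fun r => exists n, r = a n)) as [x [H1 H2]].
- exists (b O); intros r [n ->]; apply H.
- exists (a O); exists O; reflexivity.
- exists x; intros n; split; [apply H1; exists n; reflexivity|].
  apply H2; intros r [m ->]; apply H.
Qed.

(* Goursat's bisection, for a set function [J] of rectangles [a, b] x [c, d]
   that is additive in each direction. *)
Lemma rectangle_bisection (J : R -> R -> R -> R -> R) (a b c d : R) :
  (forall a m b c d, J a b c d = J a m c d + J m b c d) ->
  (forall a b c m d, J a b c d = J a b c m + J a b m d) ->
  a <= b -> c <= d ->
  (forall x y, a <= x <= b -> c <= y <= d -> forall eps, 0 < eps ->
    exists delta, 0 < delta /\ forall a' b' c' d',
      a' <= x <= b' -> c' <= y <= d' -> (b' - a') + (d' - c') < delta ->
      Rabs (J a' b' c' d') <= eps * ((b' - a') + (d' - c')) ^ 2) ->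
  J a b c d = 0.
Proof.
intros Hh Hv Hab Hcd Hloc.
set (rect := (R * R * R * R)%type).
set (ok := fun r : rect => let '(a, b, c, d) := r in a <= b /\ c <= d).
(* [sub r r']: [r'] is contained in [r], has half its sides and carries at least a quarter of
   [|J|]. *)
set (sub := fun r r' : rect => let '(a, b, c, d) := r in let '(a', b', c', d') := r' in
  ok r' /\ a <= a' /\ b' <= b /\ c <= c' /\ d' <= d /\
  b' - a' = (b - a) / 2 /\ d' - c' = (d - c) / 2 /\
  Rabs (J a b c d) <= 4 * Rabs (J a' b' c' d')).
assert (Hstep : forall r, ok r -> exists r', sub r r').
{ intros [[[a0 b0] c0] d0] [H1 H2].
  set (m := (a0 + b0) / 2); set (n := (c0 + d0) / 2).
  assert (E : J a0 b0 c0 d0 = J a0 m c0 n + J a0 m n d0 + (J m b0 c0 n + J m b0 n d0)).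
  { rewrite (Hh a0 m b0), (Hv a0 m c0 n d0), (Hv m b0 c0 n d0); ring. }
  assert (H3 : Rabs (J a0 b0 c0 d0) <=
    Rabs (J a0 m c0 n) + Rabs (J a0 m n d0) + (Rabs (J m b0 c0 n) + Rabs (J m b0 n d0))).
  { rewrite E; repeat (eapply Rle_trans; [apply Rabs_triang|]; apply Rplus_le_compat);
      try apply Rle_refl; apply Rabs_triang. }
  destruct (Rle_lt_dec (Rabs (J a0 b0 c0 d0)) (4 * Rabs (J a0 m c0 n))) as [K1|K1];
    [exists (a0, m, c0, n); unfold sub, ok, m, n in *; lra|].
  destruct (Rle_lt_dec (Rabs (J a0 b0 c0 d0)) (4 * Rabs (J a0 m n d0))) as [K2|K2];
    [exists (a0, m, n, d0); unfold sub, ok, m, n in *; lra|].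
  destruct (Rle_lt_dec (Rabs (J a0 b0 c0 d0)) (4 * Rabs (J m b0 c0 n))) as [K3|K3];
    [exists (m, b0, c0, n); unfold sub, ok, m, n in *; lra|].
  (* Three quarters each carry less than a quarter of [|J|], so by [H3] the last one carries
     enough. *)
  exists (m, b0, n, d0); unfold sub, ok, m, n in *; lra. }
set (next := fun r => epsilon (inhabits r) (sub r)).
set (seq := fix seq n := match n with O => (a, b, c, d) | S n => next (seq n) end).
assert (Hok : forall n, ok (seq n) /\ sub (seq n) (seq (S n))).
{ assert (K : forall r, ok r -> sub r (next r)).
  { intros r Hr; apply epsilon_spec, Hstep, Hr. }
  induction n as [|n [IH1 IH2]].
  - assert (ok (a, b, c, d)) by (split; assumption).
    split; [assumption|apply K; assumption].
  - assert (ok (seq (S n))).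
    { destruct (seq n) as [[[? ?] ?] ?], (seq (S n)) as [[[? ?] ?] ?]; apply IH2. }
    split; [assumption|apply K; assumption]. }
set (A := fun n => let '(a, b, c, d) := seq n in a).
set (B := fun n => let '(a, b, c, d) := seq n in b).
set (C := fun n => let '(a, b, c, d) := seq n in c).
set (D := fun n => let '(a, b, c, d) := seq n in d).
assert (Hs : forall n, A n <= A (S n) /\ B (S n) <= B n /\ C n <= C (S n) /\ D (S n) <= D n /\
  A n <= B n /\ C n <= D n /\
  B (S n) - A (S n) = (B n - A n) / 2 /\ D (S n) - C (S n) = (D n - C n) / 2 /\
  Rabs (J (A n) (B n) (C n) (D n)) <= 4 * Rabs (J (A (S n)) (B (S n)) (C (S n)) (D (S n)))).
{ intros n; destruct (Hok n) as [H1 H2]; unfold A, B, C, D.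
  destruct (seq n) as [[[? ?] ?] ?], (seq (S n)) as [[[? ?] ?] ?]; unfold sub, ok in *; tauto. }
destruct (nested_intervals A B) as [x Hx]; try (intros n; apply (Hs n)).
destruct (nested_intervals C D) as [y Hy]; try (intros n; apply (Hs n)).
assert (Hsz : forall n, (B n - A n) + (D n - C n) = ((b - a) + (d - c)) * (/ 2) ^ n).
{ induction n as [|n IH]; [change ((b - a) + (d - c) = ((b - a) + (d - c)) * 1); ring|].
  destruct (Hs n) as [_ [_ [_ [_ [_ [_ [K1 [K2 _]]]]]]]].
  rewrite K1, K2; simpl.
  replace (((b - a) + (d - c)) * (/ 2 * (/ 2) ^ n)) with (((b - a) + (d - c)) * (/ 2) ^ n / 2) by field.
  rewrite <- IH; field. }
assert (HJ : forall n, Rabs (J a b c d) * (/ 4) ^ n <= Rabs (J (A n) (B n) (C n) (D n))).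
{ induction n as [|n IH]; [change (Rabs (J a b c d) * 1 <= Rabs (J a b c d)); lra|].
  destruct (Hs n) as [_ [_ [_ [_ [_ [_ [_ [_ K]]]]]]]]; simpl; lra. }
apply Rabs_eq_0, Rle_antisym; [|apply Rabs_pos].
(* The size of the [n]-th rectangle is [2 ^ -n] times the original and [|J|] loses at most a factor
   4 per step. The quadratic local bound at the common point [(x, y)] therefore passes to the whole
   rectangle with the same [eps]. *)
apply le_of_le_plus_eps with (c := ((b - a) + (d - c)) ^ 2); intros eps He.
destruct (Hloc x y (Hx O) (Hy O) eps He) as [delta [Hd Hloc']].
(* The [+ 1] covers a rectangle reduced to a point. *)
assert (Hdd : 0 < delta / ((b - a) + (d - c) + 1)) by (apply Rdiv_lt_0_compat; lra).
destruct (pow_lt_1_zero (/ 2) ltac:(rewrite Rabs_pos_eq; lra) _ Hdd) as [n Hn].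
specialize (Hn n (le_n n)); rewrite Rabs_pos_eq in Hn by (apply pow_le; lra).
assert (Hp : 0 < (/ 2) ^ n) by (apply pow_lt; lra).
assert (Hsmall : (B n - A n) + (D n - C n) < delta).
{ rewrite Hsz.
  apply Rmult_lt_compat_l with (r := (b - a) + (d - c) + 1) in Hn; [|lra].
  replace (((b - a) + (d - c) + 1) * (delta / ((b - a) + (d - c) + 1))) with delta in Hn by (field; lra).
  lra. }
specialize (Hloc' _ _ _ _ (Hx n) (Hy n) Hsmall); rewrite Hsz, Rpow_mult_distr in Hloc'.
replace (((/ 2) ^ n) ^ 2) with ((/ 4) ^ n) in Hloc'.
2:{ rewrite <- !pow_mult, Nat.mul_comm, pow_mult; f_equal; simpl; lra. }
assert (Hp4 : 0 < (/ 4) ^ n) by (apply pow_lt; lra).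
apply Rmult_le_reg_r with (1 := Hp4).
apply Rle_trans with (1 := HJ n), Rle_trans with (1 := Hloc'); lra.
Qed.

Lemma ex_RInt_section_r (U : R -> R -> R) (s c d : R) :
  (forall s t, continuity_2d_pt U s t) -> ex_RInt (fun t => U s t) c d.
Proof.
intros HU; apply (ex_RInt_continuous (V := R_CompleteNormedModule)); intros t _.
apply continuity_pt_filterlim; intros eps He.
destruct (HU s t (mkposreal eps He)) as [e H].
exists e; split; [apply cond_pos|]; intros t' [_ Ht'].
apply H; [rewrite Rminus_diag, Rabs_R0; apply cond_pos|exact Ht'].
Qed.

Lemma ex_RInt_section_l (U : R -> R -> R) (t a b : R) :
  (forall s t, continuity_2d_pt U s t) -> ex_RInt (fun s => U s t) a b.
Proof.
intros HU; apply (ex_RInt_section_r (fun t s => U s t)).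
intros s' t' eps; destruct (HU t' s' eps) as [e H].
exists e; auto.
Qed.

Lemma RInt_close_to_const (f : R -> R) (a b k M : R) :
  a <= b -> ex_RInt f a b -> (forall t, a <= t <= b -> Rabs (f t - k) <= M) ->
  Rabs (RInt f a b - k * (b - a)) <= M * (b - a).
Proof.
intros Hab Hf H.
assert (E : RInt (fun t => f t - k) a b = RInt f a b - k * (b - a)).
{ etransitivity; [apply (RInt_minus f (fun _ => k)); [exact Hf|apply ex_RInt_const]|].
  rewrite RInt_const; change (RInt f a b - (b - a) * k = RInt f a b - k * (b - a)); ring. }
rewrite <- E, Rmult_comm; apply abs_RInt_le_const; [exact Hab| |exact H].
apply (ex_RInt_minus f (fun _ => k)); [exact Hf|apply ex_RInt_const].
Qed.

(* [U + i V] satisfies the Cauchy-Riemann equations at [(x, y)], with complex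
   derivative [al + i be]. *)
Definition cauchy_riemann_at (U V : R -> R -> R) (x y : R) : Prop :=
  exists al be, forall eps, 0 < eps -> exists delta, 0 < delta /\
    forall s t, Rabs (s - x) + Rabs (t - y) < delta ->
      Rabs (U s t - U x y - (al * (s - x) - be * (t - y))) <=
        eps * (Rabs (s - x) + Rabs (t - y)) /\
      Rabs (V s t - V x y - (be * (s - x) + al * (t - y))) <=
        eps * (Rabs (s - x) + Rabs (t - y)).

(** The imaginary part of the integral of [U + i V] around the rectangle vanishes. In the local
    estimate the affine part contributes [al] times the area to both integrals and cancels, which
    leaves an error quadratic in the size. *)
Lemma cauchy_riemann_RInt (U V : R -> R -> R) (a b c d : R) :
  (forall s t, continuity_2d_pt U s t) -> (forall s t, continuity_2d_pt V s t) ->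
  a <= b -> c <= d ->
  (forall x y, a <= x <= b -> c <= y <= d -> cauchy_riemann_at U V x y) ->
  RInt (fun t => U b t - U a t) c d = RInt (fun s => V s d - V s c) a b.
Proof.
intros HU HV Hab Hcd HCR.
assert (HU' : forall a b c d, ex_RInt (fun t => U b t - U a t) c d).
{ intros; apply (ex_RInt_minus (fun t => U b0 t) (fun t => U a0 t));
    apply ex_RInt_section_r; assumption. }
assert (HV' : forall a b c d, ex_RInt (fun s => V s d - V s c) a b).
{ intros; apply (ex_RInt_minus (fun s => V s d0) (fun s => V s c0));
    apply ex_RInt_section_l; assumption. }
set (J := fun a b c d => RInt (fun t => U b t - U a t) c d - RInt (fun s => V s d - V s c) a b).
enough (J a b c d = 0) by (unfold J in *; lra).
apply rectangle_bisection; [| |assumption|assumption|].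
- intros a0 m b0 c0 d0; unfold J.
  assert (E1 : RInt (fun t => U b0 t - U a0 t) c0 d0 =
    RInt (fun t => U m t - U a0 t) c0 d0 + RInt (fun t => U b0 t - U m t) c0 d0).
  { etransitivity; [|apply (RInt_plus (V := R_CompleteNormedModule)); apply HU'].
    apply RInt_ext; intros t _; unfold plus; simpl; ring. }
  rewrite E1, <- (RInt_Chasles (fun s => V s d0 - V s c0) a0 m b0) by apply HV'.
  unfold plus; simpl; ring.
- intros a0 b0 c0 m d0; unfold J.
  assert (E1 : RInt (fun s => V s d0 - V s c0) a0 b0 =
    RInt (fun s => V s m - V s c0) a0 b0 + RInt (fun s => V s d0 - V s m) a0 b0).
  { etransitivity; [|apply (RInt_plus (V := R_CompleteNormedModule)); apply HV'].
    apply RInt_ext; intros t _; unfold plus; simpl; ring. }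
  rewrite E1, <- (RInt_Chasles (fun t => U b0 t - U a0 t) c0 m d0) by apply HU'.
  unfold plus; simpl; ring.
- intros x y Hx Hy eps He.
  destruct (HCR x y Hx Hy) as [al [be H]].
  destruct (H (eps / 4) ltac:(lra)) as [delta [Hd Hdelta]].
  exists delta; split; [assumption|]; intros a' b' c' d' Hx' Hy' Hsize.
  set (h := (b' - a') + (d' - c')) in *.
  assert (Hdist : forall s t, a' <= s <= b' -> c' <= t <= d' ->
    Rabs (s - x) + Rabs (t - y) <= h).
  { intros s t Hs Ht; unfold h; apply Rplus_le_compat; apply Rabs_le; lra. }
  assert (Happ : forall s t, a' <= s <= b' -> c' <= t <= d' ->
    Rabs (U s t - U x y - (al * (s - x) - be * (t - y))) <= eps / 4 * h /\
    Rabs (V s t - V x y - (be * (s - x) + al * (t - y))) <= eps / 4 * h).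
  { intros s t Hs Ht; assert (K := Hdist s t Hs Ht).
    assert (K2 : eps / 4 * (Rabs (s - x) + Rabs (t - y)) <= eps / 4 * h)
      by (apply Rmult_le_compat_l; lra).
    destruct (Hdelta s t ltac:(lra)) as [K3 K4]; split; lra. }
  assert (KU : Rabs (RInt (fun t => U b' t - U a' t) c' d' - (al * (b' - a')) * (d' - c'))
    <= eps / 2 * h * (d' - c')).
  { apply RInt_close_to_const; [lra|apply HU'|]; intros t Ht.
    destruct (Happ b' t ltac:(lra) Ht) as [K1 _], (Happ a' t ltac:(lra) Ht) as [K2 _].
    apply Rabs_le_between in K1; apply Rabs_le_between in K2; apply Rabs_le; lra. }
  assert (KV : Rabs (RInt (fun s => V s d' - V s c') a' b' - (al * (d' - c')) * (b' - a'))
    <= eps / 2 * h * (b' - a')).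
  { apply RInt_close_to_const; [lra|apply HV'|]; intros s Hs.
    destruct (Happ s d' Hs ltac:(lra)) as [_ K1], (Happ s c' Hs ltac:(lra)) as [_ K2].
    apply Rabs_le_between in K1; apply Rabs_le_between in K2; apply Rabs_le; lra. }
  assert (Hh : 0 <= h) by (unfold h; lra).
  assert (E : eps / 2 * h * (d' - c') + eps / 2 * h * (b' - a') = eps / 2 * h ^ 2)
    by (unfold h; ring).
  assert (Hh2 : 0 <= eps / 2 * h ^ 2) by (apply Rmult_le_pos; [lra|apply pow_le, Hh]).
  unfold J; apply Rabs_le_between in KU; apply Rabs_le_between in KV; apply Rabs_le; lra.
Qed.

(** * Mean value property *)

Lemma ex_derive_eps (f : C -> C) (z : C) :
  ex_derive f z <-> exists l : C, forall eps, 0 < eps -> exists d, 0 < d /\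
    forall w, Cmod (w - z) < d -> Cmod (f w - f z - l * (w - z)) <= eps * Cmod (w - z).
Proof.
rewrite ex_derive_C; split.
- intros [l [_ H]]; exists l; intros eps He.
  specialize (H z (fun P HP => HP) (mkposreal eps He)).
  apply (locally_norm_le_locally (V := AbsRing_NormedModule C_AbsRing) z) in H.
  destruct H as [d Hd]; exists d; split; [apply cond_pos|].
  intros w Hw; specialize (Hd w Hw); simpl in Hd.
  rewrite Cmult_comm; exact Hd.
- intros [l H]; exists l; split; [apply is_linear_scal_l|].
  intros x Hx.
  apply (is_filter_lim_locally_unique (V := AbsRing_NormedModule C_AbsRing)) in Hx; subst x.
  intros eps; destruct (H eps (cond_pos eps)) as [d [d0 Hd]].
  apply (locally_le_locally_norm (V := AbsRing_NormedModule C_AbsRing)).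
  exists (mkposreal d d0); intros w Hw.
  specialize (Hd w Hw); rewrite Cmult_comm in Hd; exact Hd.
Qed.

Lemma Cmod_le_abs_sum (z : C) : Cmod z <= Rabs (fst z) + Rabs (snd z).
Proof.
replace z with (RtoC (fst z) + Ci * RtoC (snd z))%C at 1.
2:{ destruct z as [x y]; unfold RtoC, Ci, Cplus, Cmult; simpl; f_equal; ring. }
apply Rle_trans with (1 := Cmod_triangle _ _).
rewrite Cmod_mult, Cmod_Ci, !Cmod_R; lra.
Qed.

Lemma abs_fst_le_Cmod (z : C) : Rabs (fst z) <= Cmod z.
Proof. apply Rle_trans with (2 := Rmax_Cmod z), Rmax_l. Qed.

Lemma abs_snd_le_Cmod (z : C) : Rabs (snd z) <= Cmod z.
Proof. apply Rle_trans with (2 := Rmax_Cmod z), Rmax_r. Qed.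

(** * The logarithmic chart: [cexp s t] is the exponential of [s + i t] *)

Definition cexp (s t : R) : C := (exp s * cos t, exp s * sin t).

Lemma Cmod_cexp (s t : R) : Cmod (cexp s t) = exp s.
Proof.
unfold cexp, Cmod; simpl.
replace (_ + _) with (exp s * exp s * (Rsqr (sin t) + Rsqr (cos t))) by (unfold Rsqr; ring).
rewrite sin2_cos2, Rmult_1_r; apply sqrt_square; left; apply exp_pos.
Qed.

Lemma cexp_add (s t s' t' : R) : cexp (s + s') (t + t') = (cexp s t * cexp s' t')%C.
Proof.
unfold cexp, Cmult; simpl; rewrite exp_plus, cos_plus, sin_plus; f_equal; ring.
Qed.

Lemma exp_le_1 (s : R) : s <= 0 -> exp s <= 1.
Proof.
intros Hs; rewrite <- exp_0; destruct Hs as [Hs| ->]; [left; apply exp_increasing, Hs|lra].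
Qed.

Lemma derivable_pt_lim_at_0 (f : R -> R) (l : R) : derivable_pt_lim f 0 l ->
  forall eps, 0 < eps -> exists d, 0 < d /\
    forall h, Rabs h < d -> Rabs (f h - f 0 - l * h) <= eps * Rabs h.
Proof.
intros H eps He; destruct (H eps He) as [d Hd]; exists d; split; [apply cond_pos|].
intros h Hh; destruct (Req_dec h 0) as [->|Hz].
- rewrite Rmult_0_r, !Rminus_diag, Rabs_R0; lra.
- specialize (Hd h Hz Hh); rewrite Rplus_0_l in Hd.
  replace (f h - f 0 - l * h) with (((f h - f 0) / h - l) * h) by (field; exact Hz).
  rewrite Rabs_mult; apply Rmult_le_compat_r; [apply Rabs_pos|lra].
Qed.

Lemma cexp_expansion_0 (eps : R) : 0 < eps -> exists d, 0 < d /\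
  forall h k, Rabs h + Rabs k < d ->
    Cmod (cexp h k - 1 - (h, k)) <= eps * (Rabs h + Rabs k).
Proof.
(* The bounds below add up to [e |h| + 8 e |k|]: the real part costs 1 and 3, the imaginary part 3
   and 2. *)
intros He; set (e := eps / 8).
destruct (derivable_pt_lim_at_0 exp 1 derivable_pt_lim_exp_0 (Rmin e 1)) as [d1 [D1 H1]];
  [apply Rmin_pos; unfold e; lra|].
destruct (derivable_pt_lim_at_0 sin 1) with (eps := e) as [d2 [D2 H2]];
  [rewrite <- cos_0; apply derivable_pt_lim_sin|unfold e; lra|].
destruct (derivable_pt_lim_at_0 cos 0) with (eps := e) as [d3 [D3 H3]].
{ replace 0 with (- sin 0) at 2 by (rewrite sin_0; ring); apply derivable_pt_lim_cos. }
{ unfold e; lra. }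
exists (Rmin (Rmin d1 d2) (Rmin d3 (Rmin e 1))).
split; [repeat apply Rmin_pos; unfold e; lra|].
intros h k Hhk.
assert (Ph := Rabs_pos h); assert (Pk := Rabs_pos k).
apply Rmin_Rgt_l in Hhk; destruct Hhk as [K1 K2].
apply Rmin_Rgt_l in K1; destruct K1 as [K1 K3].
apply Rmin_Rgt_l in K2; destruct K2 as [K2 K4].
apply Rmin_Rgt_l in K4; destruct K4 as [K4 K5].
specialize (H1 h ltac:(lra)); specialize (H2 k ltac:(lra)); specialize (H3 k ltac:(lra)).
rewrite exp_0, Rmult_1_l in H1; rewrite sin_0, Rmult_1_l, Rminus_0_r in H2.
rewrite cos_0, Rmult_0_l, Rminus_0_r in H3.
assert (E3 : 0 < exp h <= 3).
{ split; [apply exp_pos|]; apply Rle_trans with (2 := exp_le_3).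
  assert (Hle : h <= 1) by (generalize (Rle_abs h); lra).
  destruct Hle as [Hlt|Heq]; [left; apply exp_increasing, Hlt|right; rewrite Heq; reflexivity]. }
assert (H1a : Rabs (exp h - 1 - h) <= e * Rabs h).
{ apply Rle_trans with (1 := H1), Rmult_le_compat_r; [exact Ph|apply Rmin_l]. }
assert (H1b : Rabs (exp h - 1) <= 2 * Rabs h).
{ replace (exp h - 1) with ((exp h - 1 - h) + h) by ring.
  apply Rle_trans with (1 := Rabs_triang _ _).
  assert (Rmin e 1 * Rabs h <= 1 * Rabs h) by (apply Rmult_le_compat_r; [exact Ph|apply Rmin_r]).
  lra. }
apply Rle_trans with (1 := Cmod_le_abs_sum _).
unfold cexp; simpl.
replace (exp h * cos k + - (1) + - h) with ((exp h - 1 - h) + exp h * (cos k - 1)) by ring.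
replace (exp h * sin k + - 0 + - k) with (exp h * (sin k - k) + (exp h - 1) * k) by ring.
assert (A1 := Rabs_triang (exp h - 1 - h) (exp h * (cos k - 1))).
assert (A2 := Rabs_triang (exp h * (sin k - k)) ((exp h - 1) * k)).
rewrite Rabs_mult, (Rabs_pos_eq (exp h)) in A1 by lra.
rewrite !Rabs_mult, (Rabs_pos_eq (exp h)) in A2 by lra.
assert (B1 : exp h * Rabs (cos k - 1) <= 3 * (e * Rabs k)).
{ apply Rmult_le_compat; try lra; apply Rabs_pos. }
assert (B2 : exp h * Rabs (sin k - k) <= 3 * (e * Rabs k)).
{ apply Rmult_le_compat; try lra; apply Rabs_pos. }
assert (B3 : Rabs (exp h - 1) * Rabs k <= 2 * (e * Rabs k)).
{ apply Rle_trans with (2 * Rabs h * Rabs k); [apply Rmult_le_compat_r; lra|].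
  rewrite Rmult_assoc; apply Rmult_le_compat_l; [lra|apply Rmult_le_compat_r; lra]. }
assert (Q : 0 <= e * Rabs h) by (apply Rmult_le_pos; unfold e; lra).
unfold e in *; lra.
Qed.

(** Chain rule: [cexp s t] is [z] times [cexp (s - x) (t - y)], so the chart has derivative [z] and
    the composite has derivative [l z]. The condition [x <= 0] gives [|z| <= 1], which keeps the
    constants uniform. *)
Lemma cexp_chart_cauchy_riemann (f : C -> C) (x y : R) : x <= 0 ->
  ex_derive f (cexp x y) ->
  cauchy_riemann_at (fun s t => fst (f (cexp s t))) (fun s t => snd (f (cexp s t))) x y.
Proof.
intros Hx Hf; apply ex_derive_eps in Hf; destruct Hf as [l Hf].
set (z := cexp x y) in *.
assert (Hz : Cmod z <= 1) by (unfold z; rewrite Cmod_cexp; apply exp_le_1, Hx).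
exists (fst (l * z)%C), (snd (l * z)%C); intros eps He.
assert (Hl := Cmod_ge_0 l).
set (e := Rmin 1 (eps / (2 * (Cmod l + 1)))).
assert (He0 : 0 < e) by (apply Rmin_pos; [lra|apply Rdiv_lt_0_compat; lra]).
assert (He1 : e <= 1) by apply Rmin_l.
assert (He2 : Cmod l * e <= eps / 2).
{ apply Rle_trans with ((Cmod l + 1) * (eps / (2 * (Cmod l + 1)))); [|right; field; lra].
  apply Rmult_le_compat; [lra|lra|lra|apply Rmin_r]. }
destruct (cexp_expansion_0 e He0) as [d1 [D1 H1]].
destruct (Hf (eps / 4) ltac:(lra)) as [d2 [D2 H2]].
(* Half of [d2] suffices because [|w - z| <= 2 D]. The final error is at most [eps / 4 * 2 D] from
   [f] plus [|l| e D] from the chart. *)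
exists (Rmin d1 (d2 / 2)); split; [apply Rmin_pos; lra|].
intros s t Hst; set (D := Rabs (s - x) + Rabs (t - y)) in *.
assert (D0 : 0 <= D) by (unfold D; generalize (Rabs_pos (s - x)) (Rabs_pos (t - y)); lra).
apply Rmin_Rgt_l in Hst; destruct Hst as [K1 K2].
specialize (H1 (s - x) (t - y) K1).
set (q := (s - x, t - y) : C) in *.
assert (Hq : Cmod q <= D) by apply Cmod_le_abs_sum.
assert (Ew : cexp s t = (z * cexp (s - x) (t - y))%C).
{ unfold z; rewrite <- cexp_add, !Rplus_minus; reflexivity. }
set (w := cexp s t) in *.
assert (L1 : Cmod (w - z - z * q) <= e * D).
{ replace (w - z - z * q)%C with (z * (cexp (s - x) (t - y) - 1 - q))%C by (rewrite Ew; clear; ring).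
  rewrite Cmod_mult; fold D in H1; generalize (Cmod_ge_0 (cexp (s - x) (t - y) - 1 - q)); nra. }
assert (L2 : Cmod (w - z) <= 2 * D).
{ replace (w - z)%C with ((w - z - z * q) + z * q)%C by ring.
  apply Rle_trans with (1 := Cmod_triangle _ _); rewrite Cmod_mult.
  generalize (Cmod_ge_0 q); nra. }
specialize (H2 w ltac:(lra)).
assert (L3 : Cmod (f w - f z - l * z * q) <= eps * D).
{ replace (f w - f z - l * z * q)%C with ((f w - f z - l * (w - z)) + l * (w - z - z * q))%C by ring.
  apply Rle_trans with (1 := Cmod_triangle _ _); rewrite Cmod_mult; nra. }
split.
- apply Rle_trans with (2 := L3), Rle_trans with (2 := abs_fst_le_Cmod _).
  right; f_equal; unfold q, z, Cmult; simpl; ring.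
- apply Rle_trans with (2 := L3), Rle_trans with (2 := abs_snd_le_Cmod _).
  right; f_equal; unfold q, z, Cmult; simpl; ring.
Qed.

(** Replacing [s] by [Rmin s 0] sends the half-plane [s > 0] to the unit circle. The chart then
    stays in the closed disc and is continuous on the whole plane, as the integration lemmas
    require. *)
Lemma cexp_chart_continuity_2d (f : C -> C) (s t : R) : continuous_on closed_disc f ->
  continuity_2d_pt (fun s t => fst (f (cexp (Rmin s 0) t))) s t /\
  continuity_2d_pt (fun s t => snd (f (cexp (Rmin s 0) t))) s t.
Proof.
rewrite continuous_on_C; intros Hf.
assert (Hin : forall s t, closed_disc (cexp (Rmin s 0) t)).
{ intros; unfold closed_disc; rewrite Cmod_cexp; apply exp_le_1, Rmin_r. }
assert (Hexp : continuity_2d_pt (fun s _ => exp (Rmin s 0)) s t).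
{ apply (continuity_1d_2d_pt_comp exp); [apply derivable_continuous, derivable_exp|].
  apply continuity_2d_pt_ext with (fun u v => (u - Rabs u) * / 2).
  { intros u v; unfold Rmin, Rabs; destruct Rle_dec, Rcase_abs; lra. }
  apply continuity_2d_pt_mult; [|apply continuity_2d_pt_const].
  apply continuity_2d_pt_minus; [apply continuity_2d_pt_id1|].
  apply (continuity_1d_2d_pt_comp Rabs (fun u _ => u)); [apply Rcontinuity_abs|apply continuity_2d_pt_id1]. }
assert (Hc : continuity_2d_pt (fun s t => exp (Rmin s 0) * cos t) s t).
{ apply continuity_2d_pt_mult; [exact Hexp|].
  apply (continuity_1d_2d_pt_comp cos (fun _ v => v)); [apply continuity_cos|apply continuity_2d_pt_id2]. }
assert (Hs : continuity_2d_pt (fun s t => exp (Rmin s 0) * sin t) s t).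
{ apply continuity_2d_pt_mult; [exact Hexp|].
  apply (continuity_1d_2d_pt_comp sin (fun _ v => v)); [apply continuity_sin|apply continuity_2d_pt_id2]. }
assert (H : forall eps : posreal, locally_2d (fun u v =>
  Cmod (f (cexp (Rmin u 0) v) - f (cexp (Rmin s 0) t)) < eps) s t).
{ intros eps; destruct (Hf _ (Hin s t) eps (cond_pos eps)) as [d [d0 Hd]].
  assert (d2 : 0 < d / 2) by lra.
  generalize (Hc (mkposreal _ d2)); intros Hc'; generalize (Hs (mkposreal _ d2)); intros Hs'.
  generalize (locally_2d_and _ _ _ _ Hc' Hs'); apply locally_2d_impl, locally_2d_forall.
  simpl; intros u v [A1 A2]; apply Hd; [apply Hin|].
  apply Rle_lt_trans with (1 := Cmod_le_abs_sum _); simpl; unfold Rminus in *; lra. }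
split; intros eps; generalize (H eps); apply locally_2d_impl, locally_2d_forall; intros u v;
  apply Rle_lt_trans; [apply (abs_fst_le_Cmod (_ - _)%C)|apply (abs_snd_le_Cmod (_ - _)%C)].
Qed.

(** The mean of the real part of [f] on the circle of radius [exp s] is the same for all [s < 0]. It
    is compared with [f 0] for very negative [s] and with the boundary values for [s] near 0. *)
Lemma fst_center_le_boundary (f : C -> C) (M : R) :
  (forall z, open_disc z -> ex_derive f z) -> continuous_on closed_disc f ->
  (forall z, unit_circle z -> fst (f z) <= M) -> fst (f 0%C) <= M.
Proof.
intros Hd Hc HM.
set (U := fun s t => fst (f (cexp (Rmin s 0) t))).
set (V := fun s t => snd (f (cexp (Rmin s 0) t))).
assert (HU : forall s t, continuity_2d_pt U s t) by (intros; apply cexp_chart_continuity_2d, Hc).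
assert (HV : forall s t, continuity_2d_pt V s t) by (intros; apply cexp_chart_continuity_2d, Hc).
assert (Hpi := PI_RGT_0).
assert (Hmean : forall a b, a <= b -> b < 0 ->
  RInt (fun t => U b t) 0 (2 * PI) = RInt (fun t => U a t) 0 (2 * PI)).
{ intros a b Hab Hb.
  assert (E := cauchy_riemann_RInt U V a b 0 (2 * PI) HU HV Hab ltac:(lra)).
  rewrite (RInt_ext (fun s => V s (2 * PI) - V s 0) (fun _ => 0)) in E.
  2:{ intros s _; unfold V, cexp.
      rewrite cos_2PI, sin_2PI, cos_0, sin_0; apply Rminus_diag. }
  rewrite RInt_const in E.
  rewrite (RInt_minus (fun t => U b t) (fun t => U a t)) in E by (apply ex_RInt_section_r, HU).
  unfold minus, plus, opp, scal in E; simpl in E; unfold mult in E; simpl in E.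
  apply Rminus_diag_uniq; unfold Rminus; rewrite E; [ring|].
  intros x y Hx Hy.
  destruct (cexp_chart_cauchy_riemann f x y ltac:(lra)) as [al [be HCR]].
  { apply Hd; unfold open_disc; rewrite Cmod_cexp, <- exp_0; apply exp_increasing; lra. }
  exists al, be; intros eps He; destruct (HCR eps He) as [d [d0 H]].
  (* The second bound keeps [s] negative, where [Rmin s 0] is [s]. *)
  exists (Rmin d (- x)); split; [apply Rmin_pos; lra|].
  intros s t Hst; apply Rmin_Rgt_l in Hst; destruct Hst as [K1 K2].
  unfold U, V; rewrite !Rmin_left by (generalize (Rle_abs (s - x)) (Rabs_pos (t - y)); lra).
  apply H, K1. }
apply le_of_le_plus_eps with (c := 2); intros eps He.
rewrite continuous_on_C in Hc.
assert (H0 : closed_disc 0%C) by (unfold closed_disc; rewrite Cmod_0; lra).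
destruct (Hc 0%C H0 eps He) as [d0 [D0 K0]].
destruct (uniform_continuity_2d U (-1) 0 0 (2 * PI)) with (eps := mkposreal eps He) as [d1 K1];
  [auto|].
(* On the circle of radius [exp b], [U] is within [eps] of its boundary values. On that of radius
   [exp a], chosen next, [f] is within [eps] of [f 0]. *)
set (b := - Rmin (d1 / 2) 1).
assert (Hb : -1 <= b < 0 /\ Rabs (b - 0) < d1).
{ unfold b; assert (P := cond_pos d1).
  assert (0 < Rmin (d1 / 2) 1) by (apply Rmin_pos; lra).
  assert (Rmin (d1 / 2) 1 <= 1) by apply Rmin_r.
  assert (Rmin (d1 / 2) 1 <= d1 / 2) by apply Rmin_l.
  rewrite Rminus_0_r, Rabs_Ropp, Rabs_pos_eq; lra. }
set (a := Rmin b (ln (d0 / 2))).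
assert (Ha : a <= b /\ exp a < d0).
{ split; [apply Rmin_l|].
  apply Rle_lt_trans with (d0 / 2); [|lra].
  rewrite <- (exp_ln (d0 / 2)) by lra.
  destruct (Rmin_r b (ln (d0 / 2))) as [Hlt|Heq]; [left; apply exp_increasing, Hlt|].
  right; unfold a; rewrite Heq; reflexivity. }
assert (Ka : (2 * PI - 0) * (fst (f 0%C) - eps) <= RInt (fun t => U a t) 0 (2 * PI)).
{ replace ((2 * PI - 0) * (fst (f 0%C) - eps)) with (RInt (fun _ => fst (f 0%C) - eps) 0 (2 * PI))
    by apply (RInt_const (V := R_CompleteNormedModule)).
  apply RInt_le; [lra|apply ex_RInt_const|apply ex_RInt_section_r, HU|].
  intros t _; unfold U; rewrite Rmin_left by lra.
  assert (K2 : Cmod (f (cexp a t) - f 0%C) < eps).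
  { apply K0.
    - unfold closed_disc; rewrite Cmod_cexp; apply exp_le_1; lra.
    - replace (cexp a t - 0)%C with (cexp a t) by ring; rewrite Cmod_cexp; lra. }
  generalize (abs_fst_le_Cmod (f (cexp a t) - f 0%C)); simpl; intros K3.
  apply Rle_lt_trans with (1 := K3), Rabs_lt_between in K2; lra. }
assert (Kb : RInt (fun t => U b t) 0 (2 * PI) <= (2 * PI - 0) * (M + eps)).
{ replace ((2 * PI - 0) * (M + eps)) with (RInt (fun _ => M + eps) 0 (2 * PI))
    by apply (RInt_const (V := R_CompleteNormedModule)).
  apply RInt_le; [lra|apply ex_RInt_section_r, HU|apply ex_RInt_const|].
  intros t Ht.
  assert (K2 : Rabs (U b t - U 0 t) < eps).
  { apply (K1 0 t b t); try lra; rewrite Rminus_diag, Rabs_R0; apply cond_pos. }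
  assert (K3 : U 0 t <= M).
  { unfold U; apply HM; unfold unit_circle; rewrite Cmod_cexp, Rmin_left, exp_0; lra. }
  apply Rabs_lt_between in K2; lra. }
rewrite (Hmean a b) in Kb by lra.
apply Rmult_le_reg_l with (2 * PI - 0); lra.
Qed.

(** * Maximum modulus principle *)

(** Unlike [in_disc_algebra], this leaves the values outside the closed disc free, so explicit
    formulas qualify; [da_exists] turns them into elements of the algebra. *)
Definition disc_holomorphic (f : C -> C) : Prop :=
  (forall z, open_disc z -> ex_derive f z) /\ continuous_on closed_disc f.

Lemma da_holomorphic (f : disc_algebra) : disc_holomorphic f.
Proof. destruct (da_in f) as [H1 [H2 _]]; split; assumption. Qed.

(** Truncation to 0 off the closed disc does not affect derivatives, because the open disc is a
    neighbourhood of each of its points. *)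
Lemma da_exists (g : C -> C) : disc_holomorphic g ->
  exists f : disc_algebra, forall z, closed_disc z -> f z = g z.
Proof.
intros [H1 H2].
set (f := fun z => if excluded_middle_informative (closed_disc z) then g z else 0%C).
assert (E : forall z, closed_disc z -> f z = g z).
{ intros z Hz; unfold f; destruct excluded_middle_informative; tauto. }
enough (Hf : in_disc_algebra f) by (exists (Disc_algebra f Hf); exact E).
split; [|split].
- intros z Hz; destruct (proj1 (ex_derive_eps g z) (H1 z Hz)) as [l Hl].
  apply ex_derive_eps; exists l; intros eps He; destruct (Hl eps He) as [d [d0 Hd]].
  unfold open_disc in Hz.
  exists (Rmin d (1 - Cmod z)); split; [apply Rmin_pos; lra|].
  intros w Hw; apply Rmin_Rgt_l in Hw; destruct Hw as [K1 K2].
  rewrite !E; [apply Hd, K1|unfold closed_disc; lra|].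
  unfold closed_disc; replace w with ((w - z) + z)%C by ring.
  apply Rle_trans with (1 := Cmod_triangle _ _); lra.
- apply continuous_on_C; intros z Hz eps He.
  destruct (proj1 (continuous_on_C _ _) H2 z Hz eps He) as [d [d0 Hd]].
  exists d; split; [assumption|]; intros w Hw Hwz; rewrite !E by assumption; auto.
- intros z Hz; unfold f; destruct excluded_middle_informative; tauto.
Qed.

Lemma continuous_on_ex_derive (D : C -> Prop) (f : C -> C) :
  (forall z, D z -> ex_derive f z) -> continuous_on D f.
Proof.
intros Hf; apply continuous_on_C; intros z Dz eps He.
destruct (proj1 (ex_derive_eps f z) (Hf z Dz)) as [l Hl].
destruct (Hl 1 Rlt_0_1) as [d [d0 Hd]].
assert (L := Cmod_ge_0 l).
exists (Rmin d (eps / (Cmod l + 2))).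
split; [apply Rmin_pos; [lra|apply Rdiv_lt_0_compat; lra]|].
intros w _ Hw; apply Rmin_Rgt_l in Hw; destruct Hw as [K1 K2].
specialize (Hd w K1).
assert (K3 : (Cmod l + 2) * Cmod (w - z) < eps).
{ apply Rmult_lt_compat_l with (r := Cmod l + 2) in K2; [|lra].
  replace ((Cmod l + 2) * (eps / (Cmod l + 2))) with eps in K2 by (field; lra); exact K2. }
replace (f w - f z)%C with ((f w - f z - l * (w - z)) + l * (w - z))%C by ring.
apply Rle_lt_trans with (1 := Cmod_triangle _ _); rewrite Cmod_mult.
generalize (Cmod_ge_0 (w - z)); lra.
Qed.

Lemma ex_derive_C_inv (z : C) : z <> 0%C -> ex_derive Cinv z.
Proof.
intros Hz; apply ex_derive_eps; exists (- (/ z * / z))%C; intros eps He.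
assert (Pz := proj1 (Cmod_gt_0 z) Hz).
(* The error is [(w - z) ^ 2 / (w z ^ 2)], and [|w| >= |z| / 2] bounds the denominator below by
   [|z| ^ 3 / 2]. *)
assert (P3 : 0 < eps * Cmod z ^ 3 / 2) by (generalize (pow_lt _ 3 Pz); nra).
exists (Rmin (Cmod z / 2) (eps * Cmod z ^ 3 / 2)); split; [apply Rmin_pos; lra|].
intros w Hw; apply Rmin_Rgt_l in Hw; destruct Hw as [K1 K2].
assert (Pw : Cmod z / 2 <= Cmod w).
{ assert (K3 := Cmod_triangle w (z - w)).
  replace (w + (z - w))%C with z in K3 by ring.
  rewrite (Cmod_minus_sym z w) in K3; lra. }
assert (Hw0 : w <> 0%C) by (apply Cmod_gt_0; lra).
replace (/ w - / z - - (/ z * / z) * (w - z))%C with ((w - z) * ((w - z) * / (w * z * z)))%C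
  by (field; auto).
rewrite Cmod_mult, Rmult_comm; apply Rmult_le_compat_r; [apply Cmod_ge_0|].
rewrite Cmod_mult, Cmod_inv, !Cmod_mult by (repeat apply Cmult_neq_0; assumption).
assert (P4 : 0 < Cmod w * Cmod z * Cmod z) by (repeat apply Rmult_lt_0_compat; lra).
apply Rmult_le_reg_r with (1 := P4).
rewrite Rmult_assoc, Rinv_l, Rmult_1_r by lra.
apply Rlt_le, Rlt_le_trans with (1 := K2).
replace (eps * Cmod z ^ 3 / 2) with (eps * (Cmod z / 2 * Cmod z * Cmod z)) by (simpl; field).
apply Rmult_le_compat_l; [lra|].
repeat apply Rmult_le_compat_r; lra.
Qed.

(** * Closure properties of the functions holomorphic in the disc and continuous up to the circle *)

Lemma disc_holomorphic_const (c : C) : disc_holomorphic (fun _ => c).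
Proof.
split; [intros z _; apply ex_derive_const|intros z _; apply filterlim_const].
Qed.

Lemma ex_derive_C_id (z : C) : ex_derive (V := C_NormedModule) (fun w : C => w) z.
Proof. apply ex_derive_C; exact (ex_derive_id (K := C_AbsRing) z). Qed.

Lemma disc_holomorphic_id : disc_holomorphic (fun z => z).
Proof.
split; [intros z _; apply ex_derive_C_id|].
apply continuous_on_ex_derive; intros z _; apply ex_derive_C_id.
Qed.

Lemma disc_holomorphic_plus (f g : C -> C) : disc_holomorphic f -> disc_holomorphic g ->
  disc_holomorphic (fun z => (f z + g z)%C).
Proof.
intros [F1 F2] [G1 G2]; split; [|apply continuous_on_Cplus; assumption].
intros z Hz.
exact (ex_derive_plus (K := C_AbsRing) (V := C_NormedModule) f g z (F1 z Hz) (G1 z Hz)).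
Qed.

Lemma disc_holomorphic_mult (f g : C -> C) : disc_holomorphic f -> disc_holomorphic g ->
  disc_holomorphic (fun z => (f z * g z)%C).
Proof.
intros [F1 F2] [G1 G2]; split; [|apply continuous_on_Cmult; assumption].
intros z Hz; apply ex_derive_C_mult; auto.
Qed.

Lemma disc_holomorphic_minus (f g : C -> C) : disc_holomorphic f -> disc_holomorphic g ->
  disc_holomorphic (fun z => (f z - g z)%C).
Proof.
intros Hf Hg.
replace (fun z => (f z - g z)%C) with (fun z => (f z + - (1) * g z)%C)
  by (apply functional_extensionality; intros z; ring).
apply disc_holomorphic_plus, disc_holomorphic_mult; auto using disc_holomorphic_const.
Qed.

Lemma disc_holomorphic_pow (f : C -> C) (n : nat) : disc_holomorphic f ->
  disc_holomorphic (fun z => (f z ^ n)%C).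
Proof.
intros Hf; induction n as [|n IH]; simpl; [apply disc_holomorphic_const|].
apply disc_holomorphic_mult; assumption.
Qed.

Lemma disc_holomorphic_inv (f : C -> C) : disc_holomorphic f ->
  (forall z, closed_disc z -> f z <> 0%C) -> disc_holomorphic (fun z => (/ f z)%C).
Proof.
intros [F1 F2] H; split.
- intros z Hz; apply (ex_derive_C_comp Cinv f z); [|auto].
  apply ex_derive_C_inv, H; left; exact Hz.
- apply (continuous_on_Ccomp _ (fun z => z <> 0%C)); [exact H| |exact F2].
  apply continuous_on_ex_derive, ex_derive_C_inv.
Qed.

Lemma disc_holomorphic_comp (f g : C -> C) : disc_holomorphic f -> disc_holomorphic g ->
  (forall z, open_disc z -> open_disc (g z)) ->
  (forall z, closed_disc z -> closed_disc (g z)) ->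
  disc_holomorphic (fun z => f (g z)).
Proof.
intros [F1 F2] [G1 G2] H1 H2; split.
- intros z Hz; apply ex_derive_C_comp; auto.
- apply (continuous_on_Ccomp _ closed_disc); assumption.
Qed.

Lemma Cmod_unit_phase (z : C) : exists c : C, Cmod c = 1 /\ (c * z)%C = RtoC (Cmod z).
Proof.
destruct (Ceq_dec z 0%C) as [->|Hz].
- exists 1%C; rewrite Cmod_1, Cmod_0; split; [reflexivity|ring].
- assert (P := proj1 (Cmod_gt_0 z) Hz).
  assert (Hm : RtoC (Cmod z) <> 0%C) by (intros E; apply RtoC_inj in E; lra).
  exists (RtoC (Cmod z) / z)%C; split.
  + rewrite Cmod_div, Cmod_R, Rabs_pos_eq by (assumption || lra); field; lra.
  + field; assumption.
Qed.

(** A rotation makes [f 0] real and nonnegative, so the bound on real parts applies. *)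
Lemma max_modulus_center (f : C -> C) (M : R) : disc_holomorphic f ->
  (forall z, unit_circle z -> Cmod (f z) <= M) -> Cmod (f 0%C) <= M.
Proof.
intros Hf HM; destruct (Cmod_unit_phase (f 0%C)) as [c [Hc E]].
assert (Hcf : disc_holomorphic (fun z => (c * f z)%C))
  by (apply disc_holomorphic_mult; [apply disc_holomorphic_const|exact Hf]).
replace (Cmod (f 0%C)) with (fst (c * f 0)%C) by (rewrite E; reflexivity).
apply (fst_center_le_boundary (fun z => (c * f z)%C)); try apply Hcf.
intros z Hz; apply Rle_trans with (1 := Rle_abs _), Rle_trans with (1 := abs_fst_le_Cmod _).
rewrite Cmod_mult, Hc, Rmult_1_l; auto.
Qed.

(** Compares the denominator and numerator of [(z + a) / (1 + conj a z)]. For [|a| < 1] this map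
    sends the disc into itself and the circle into itself. *)
Lemma mobius_Cmod_sqr (a z : C) :
  Cmod (1 + Cconj a * z) ^ 2 = Cmod (z + a) ^ 2 + (1 - Cmod a ^ 2) * (1 - Cmod z ^ 2).
Proof.
rewrite !Cmod2_alt; destruct a as [a1 a2], z as [x y]; simpl; ring.
Qed.

Lemma mobius_den_neq_0 (a z : C) : open_disc a -> closed_disc z -> (1 + Cconj a * z)%C <> 0%C.
Proof.
unfold open_disc, closed_disc; intros Ha Hz E.
assert (K := Cmod_triangle (1 + Cconj a * z) (- (Cconj a * z))).
replace (1 + Cconj a * z + - (Cconj a * z))%C with (RtoC 1) in K by ring.
rewrite E, Cmod_1, Cmod_0, Cmod_opp, Cmod_mult, Cmod_conj in K.
generalize (Cmod_ge_0 z) (Cmod_ge_0 a); nra.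
Qed.

(** Composition with the Moebius map that takes 0 to [a] reduces an interior point [a] to the
    centre. *)
Lemma max_modulus (f : C -> C) (M : R) : disc_holomorphic f ->
  (forall z, unit_circle z -> Cmod (f z) <= M) ->
  forall z, closed_disc z -> Cmod (f z) <= M.
Proof.
intros Hf HM a [Ha|Ha]; [|auto].
set (m := fun z => ((z + a) * / (1 + Cconj a * z))%C).
assert (Hden : forall z, closed_disc z -> (1 + Cconj a * z)%C <> 0%C)
  by (intros; apply mobius_den_neq_0; assumption).
assert (Ea : m 0%C = a) by (unfold m; field; apply Hden; unfold closed_disc; rewrite Cmod_0; lra).
assert (Hm : forall z, closed_disc z ->
  Cmod (m z) ^ 2 * Cmod (1 + Cconj a * z) ^ 2 = Cmod (z + a) ^ 2 /\ 0 < Cmod (1 + Cconj a * z)).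
{ intros z Hz; assert (P := proj1 (Cmod_gt_0 _) (Hden z Hz)); split; [|exact P].
  unfold m; rewrite Cmod_mult, Cmod_inv by auto; field; lra. }
assert (A0 := Cmod_ge_0 a); assert (A2 : 0 < 1 - Cmod a ^ 2) by (simpl; nra).
assert (Hopen : forall z, open_disc z -> open_disc (m z)).
{ intros z Hz; destruct (Hm z (Rlt_le _ _ Hz)) as [E P]; unfold open_disc in *.
  assert (K := mobius_Cmod_sqr a z); rewrite <- E in K.
  assert (Z0 := Cmod_ge_0 z); assert (Z2 : 0 < 1 - Cmod z ^ 2) by (simpl; nra).
  assert (Q := pow_lt _ 2 P); assert (M0 := Cmod_ge_0 (m z)).
  apply Rnot_le_lt; intros Hle; assert (1 <= Cmod (m z) ^ 2) by (simpl; nra).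
  nra. }
assert (Hcircle : forall z, unit_circle z -> unit_circle (m z)).
{ intros z Hz; destruct (Hm z (Req_le _ _ Hz)) as [E P]; unfold unit_circle in *.
  assert (K := mobius_Cmod_sqr a z); rewrite <- E, Hz in K.
  assert (Q := pow_lt _ 2 P); assert (M0 := Cmod_ge_0 (m z)).
  assert (S : Cmod (m z) ^ 2 = 1) by (apply Rmult_eq_reg_r with (Cmod (1 + Cconj a * z) ^ 2); lra).
  simpl in S; nra. }
rewrite <- Ea; apply (max_modulus_center (fun z => f (m z))).
- apply disc_holomorphic_comp; [exact Hf| |exact Hopen|].
  + apply disc_holomorphic_mult.
    * apply disc_holomorphic_plus; [apply disc_holomorphic_id|apply disc_holomorphic_const].
    * apply disc_holomorphic_inv; [|exact Hden].
      apply disc_holomorphic_plus; [apply disc_holomorphic_const|].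
      apply disc_holomorphic_mult; [apply disc_holomorphic_const|apply disc_holomorphic_id].
  + intros z [Hz|Hz]; [left; apply Hopen, Hz|right; apply Hcircle, Hz].
- intros z Hz; apply HM, Hcircle, Hz.
Qed.

(* The maximum principle for [(f - f w0)^2 / (z - w0)]: thanks to the square, its
   differentiability at [w0] does not require a removable singularity theorem. *)
Lemma bounded_holder_half (f : C -> C) (w0 w : C) : disc_holomorphic f ->
  (forall z, closed_disc z -> Cmod (f z) <= 1) -> open_disc w0 -> closed_disc w ->
  Cmod (f w - f w0) ^ 2 * (1 - Cmod w0) <= 4 * Cmod (w - w0).
Proof.
intros Hf H1 Hw0 Hw.
set (g := fun z => (f z - f w0)%C).
set (h := fun z => (g z * (g z * / (z - w0)))%C).
assert (Hg : disc_holomorphic g)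
  by (apply disc_holomorphic_minus; [exact Hf|apply disc_holomorphic_const]).
assert (Hid : disc_holomorphic (fun z => (z - w0)%C))
  by (apply disc_holomorphic_minus; [apply disc_holomorphic_id|apply disc_holomorphic_const]).
assert (Hne : forall z, z <> w0 -> (z - w0)%C <> 0%C).
{ intros z Hz E; apply Hz; replace z with ((z - w0) + w0)%C by ring; rewrite E; ring. }
assert (Hg0 : g w0 = 0%C) by (unfold g; ring).
assert (Hder : forall z, open_disc z -> ex_derive h z).
{ intros z Hz; destruct (Ceq_dec z w0) as [->|Hzw].
  - destruct (proj1 (ex_derive_eps _ _) (proj1 Hf w0 Hw0)) as [l Hl].
    (* Off [w0], [h z] is [q ^ 2 (z - w0)] with [q] the difference quotient of [f], which tends to
       [l]. At [w0] the factor [g w0 = 0] forces [h w0 = 0], whatever value the inverse of 0 has. *)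
    apply ex_derive_eps; exists (l * l)%C; intros eps He.
    assert (L := Cmod_ge_0 l).
    set (e := Rmin 1 (eps / (2 * Cmod l + 1))).
    assert (He0 : 0 < e) by (apply Rmin_pos; [lra|apply Rdiv_lt_0_compat; lra]).
    assert (He1 : e <= 1) by apply Rmin_l.
    assert (He2 : e * (2 * Cmod l + 1) <= eps).
    { apply Rle_trans with (eps / (2 * Cmod l + 1) * (2 * Cmod l + 1)); [|right; field; lra].
      apply Rmult_le_compat_r; [lra|apply Rmin_r]. }
    destruct (Hl e He0) as [d [d0 Hd]]; exists d; split; [assumption|].
    intros z Hzd; specialize (Hd z Hzd).
    assert (Eh : h w0 = 0%C) by (unfold h; rewrite Hg0; ring).
    rewrite Eh.
    destruct (Ceq_dec z w0) as [->|Hzw].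
    { rewrite Eh; replace (0 - 0 - l * l * (w0 - w0))%C with (RtoC 0) by ring.
      rewrite Cmod_0; apply Rmult_le_pos; [lra|apply Cmod_ge_0]. }
    assert (Hzn := Hne z Hzw); assert (Pz := proj1 (Cmod_gt_0 _) Hzn).
    set (q := (g z * / (z - w0))%C).
    assert (Eg : g z = ((z - w0) * q)%C) by (unfold q; field; exact Hzn).
    assert (Hq : Cmod (q - l) <= e).
    { apply Rmult_le_reg_r with (1 := Pz); rewrite <- Cmod_mult.
      replace ((q - l) * (z - w0))%C with (f z - f w0 - l * (z - w0))%C; [exact Hd|].
      unfold g in Eg; rewrite Eg; ring. }
    assert (Hql : Cmod (q + l) <= 2 * Cmod l + 1).
    { replace (q + l)%C with ((q - l) + (l + l))%C by ring.
      apply Rle_trans with (1 := Cmod_triangle _ _).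
      generalize (Cmod_triangle l l); lra. }
    replace (h z - 0 - l * l * (z - w0))%C with ((q - l) * (q + l) * (z - w0))%C.
    2:{ replace (h z) with (g z * q)%C by reflexivity; rewrite Eg; ring. }
    rewrite !Cmod_mult; apply Rmult_le_compat_r; [lra|].
    apply Rle_trans with (2 := He2).
    apply Rmult_le_compat; auto using Cmod_ge_0.
  - apply ex_derive_C_mult; [apply Hg, Hz|]; apply ex_derive_C_mult; [apply Hg, Hz|].
    apply (ex_derive_C_comp Cinv (fun z => z - w0)%C z);
      [apply ex_derive_C_inv, Hne, Hzw|apply Hid, Hz]. }
assert (Hcont : continuous_on closed_disc h).
{ apply continuous_on_C; intros z Hz.
  destruct (Ceq_dec z w0) as [->|Hzw].
  - assert (K := continuous_on_ex_derive _ _ Hder).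
    intros eps He; destruct (proj1 (continuous_on_C _ _) K w0 Hw0 eps He) as [d [d0 Hd]].
    unfold open_disc in *; exists (Rmin d (1 - Cmod w0)); split; [apply Rmin_pos; lra|].
    intros z Hz' Hzd; apply Rmin_Rgt_l in Hzd; destruct Hzd as [K1 K2].
    apply Hd; [|exact K1].
    replace z with ((z - w0) + w0)%C by ring.
    apply Rle_lt_trans with (1 := Cmod_triangle _ _); lra.
  - set (D := fun z => closed_disc z /\ z <> w0).
    assert (sub : forall k : C -> C, continuous_on closed_disc k -> continuous_on D k).
    { intros k Hk; apply continuous_on_C; intros x [Dx _] eps He.
      destruct (proj1 (continuous_on_C _ _) Hk x Dx eps He) as [d [d0 Hd]].
      exists d; split; [assumption|]; intros y [Dy _]; auto. }
    assert (K : continuous_on D h).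
    { apply continuous_on_Cmult; [apply sub, Hg|].
      apply continuous_on_Cmult; [apply sub, Hg|].
      apply (continuous_on_Ccomp _ (fun z => z <> 0%C)); [intros x [_ Hx]; apply Hne, Hx| |].
      - apply continuous_on_ex_derive, ex_derive_C_inv.
      - apply sub, Hid. }
    intros eps He; destruct (proj1 (continuous_on_C _ _) K z (conj Hz Hzw) eps He) as [d [d0 Hd]].
    assert (Pz := proj1 (Cmod_gt_0 _) (Hne z Hzw)).
    exists (Rmin d (Cmod (z - w0))); split; [apply Rmin_pos; lra|].
    intros x Hx Hxd; apply Rmin_Rgt_l in Hxd; destruct Hxd as [K1 K2].
    apply Hd; [|exact K1]; split; [exact Hx|].
    intros ->; rewrite Cmod_minus_sym in K2; lra. }
destruct (Ceq_dec w w0) as [->|Hww].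
{ replace (f w0 - f w0)%C with (RtoC 0) by ring; rewrite Cmod_0.
  generalize (Cmod_ge_0 (w0 - w0)); simpl; lra. }
unfold open_disc in Hw0.
(* On the circle [|g| <= 2] and [|z - w0| >= 1 - |w0|]. *)
assert (Hbound : Cmod (h w) <= 4 / (1 - Cmod w0)).
{ apply max_modulus; [split; assumption| |exact Hw].
  intros z Hz.
  assert (K1 : 1 - Cmod w0 <= Cmod (z - w0)).
  { assert (K2 := Cmod_triangle (z - w0) w0); replace (z - w0 + w0)%C with z in K2 by ring.
    unfold unit_circle in Hz; lra. }
  assert (K3 : Cmod (g z) <= 2).
  { unfold g, Cminus; apply Rle_trans with (1 := Cmod_triangle _ _); rewrite Cmod_opp.
    assert (Cmod (f z) <= 1) by (apply H1; right; exact Hz).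
    assert (Cmod (f w0) <= 1) by (apply H1; left; exact Hw0); lra. }
  unfold h; rewrite !Cmod_mult, Cmod_inv by (apply Cmod_gt_0; lra).
  assert (K4 := Cmod_ge_0 (g z)).
  assert (K5 : / Cmod (z - w0) <= / (1 - Cmod w0)) by (apply Rinv_le_contravar; lra).
  assert (K6 : 0 < / Cmod (z - w0)) by (apply Rinv_0_lt_compat; lra).
  unfold Rdiv; rewrite <- Rmult_assoc; apply Rmult_le_compat; nra. }
assert (Pw := proj1 (Cmod_gt_0 _) (Hne w Hww)).
assert (E : Cmod (f w - f w0) ^ 2 = Cmod (h w) * Cmod (w - w0)).
{ unfold h; rewrite !Cmod_mult, Cmod_inv by auto; unfold g; field; lra. }
rewrite E.
apply Rmult_le_compat_r with (r := 1 - Cmod w0) in Hbound; [|lra].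
replace (4 / (1 - Cmod w0) * (1 - Cmod w0)) with 4 in Hbound by (field; lra).
replace (Cmod (h w) * Cmod (w - w0) * (1 - Cmod w0))
  with (Cmod (h w) * (1 - Cmod w0) * Cmod (w - w0)) by ring.
apply Rmult_le_compat_r; lra.
Qed.

(* If [phi] took only values in [l] where [g] is large, then
   [g ^ n * prod (phi - c)] would be at most [m ^ n] times a constant. *)
Lemma boundary_point_avoiding (phi g : disc_algebra) (l : list C) (m : R) (z' : C) :
  disc_self_map phi ->
  (forall c, In c l -> Cmod c = 1) -> 0 <= m -> open_disc z' -> m < Cmod (g z') ->
  exists z, unit_circle z /\ m < Cmod (g z) /\ ~ In (phi z) l.
Proof.
intros Hphi Hl Hm Hz' Hgz'; apply NNPP; intros Hno.
set (Q := fun z => fold_right (fun c q => ((phi z - c) * q)%C) (RtoC 1) l).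
assert (Hphi1 : forall z, closed_disc z -> Cmod (phi z) <= 1).
{ apply da_closed_bound; intros z Hz; left; apply Hphi, Hz. }
assert (HQ : disc_holomorphic Q).
{ unfold Q; clear; induction l as [|c l IH]; simpl; [apply disc_holomorphic_const|].
  apply (disc_holomorphic_mult (fun z => phi z - c)%C); [|exact IH].
  apply disc_holomorphic_minus; [apply da_holomorphic|apply disc_holomorphic_const]. }
assert (HQ1 : forall z, closed_disc z -> Cmod (Q z) <= 2 ^ length l).
{ intros z Hz; specialize (Hphi1 z Hz); unfold Q; clear - Hl Hphi1.
  induction l as [|c l IH]; simpl; [rewrite Cmod_1; lra|].
  rewrite Cmod_mult; apply Rmult_le_compat; try apply Cmod_ge_0.
  - unfold Cminus; apply Rle_trans with (1 := Cmod_triangle _ _).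
    rewrite Cmod_opp, (Hl c) by (left; reflexivity); lra.
  - apply IH; intros c' Hc'; apply Hl; right; exact Hc'. }
(* Each factor is nonzero at [z']: [phi z'] is inside the disc, while the points of [l] lie on the
   circle. *)
assert (HQ2 : 0 < Cmod (Q z')).
{ apply Cmod_gt_0; specialize (Hphi z' Hz'); unfold Q, open_disc in *; clear - Hl Hphi.
  induction l as [|c l IH]; simpl; [intros E; apply RtoC_inj in E; lra|].
  apply Cmult_neq_0; [|apply IH; intros c' Hc'; apply Hl; right; exact Hc'].
  intros E; assert (Ec : phi z' = c)
    by (replace (phi z') with ((phi z' - c) + c)%C by ring; rewrite E; ring).
  rewrite Ec, (Hl c) in Hphi by (left; reflexivity); lra. }
assert (HQ3 : forall z, unit_circle z -> m < Cmod (g z) -> Q z = 0%C).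
{ intros z Hz Hgz; assert (Hin : In (phi z) l).
  { apply NNPP; intros Hn; apply Hno; exists z; auto. }
  unfold Q; clear - Hin; induction l as [|c l IH]; simpl; [destruct Hin|].
  destruct Hin as [->|Hin]; [ring|rewrite IH by exact Hin; ring]. }
assert (K : forall n, Cmod (g z') ^ n * Cmod (Q z') <= m ^ n * 2 ^ length l).
{ intros n; rewrite <- Cmod_pow, <- Cmod_mult.
  apply (max_modulus (fun z => g z ^ n * Q z)%C); [| |left; exact Hz'].
  - apply disc_holomorphic_mult; [apply disc_holomorphic_pow, da_holomorphic|exact HQ].
  - intros z Hz; assert (Hzc : closed_disc z) by (right; exact Hz).
    rewrite Cmod_mult, Cmod_pow.
    destruct (Rle_lt_dec (Cmod (g z)) m) as [Hle|Hlt].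
    + apply Rmult_le_compat; [apply pow_le, Cmod_ge_0|apply Cmod_ge_0| |auto].
      apply pow_incr; split; [apply Cmod_ge_0|exact Hle].
    + rewrite (HQ3 z Hz Hlt), Cmod_0, Rmult_0_r.
      apply Rmult_le_pos; apply pow_le; lra. }
(* Since [m < |g z'|], the ratio [(m / |g z'|) ^ n] tends to 0, which contradicts [K] for large
   [n]. *)
assert (Hr : Rabs (m / Cmod (g z')) < 1).
{ rewrite Rabs_pos_eq by (apply Rdiv_le_0_compat; lra); apply Rlt_div_l; lra. }
assert (P2 : 0 < 2 ^ length l) by (apply pow_lt; lra).
assert (Pe : 0 < Cmod (Q z') / 2 ^ length l) by (apply Rdiv_lt_0_compat; lra).
destruct (pow_lt_1_zero _ Hr _ Pe) as [n Hn]; specialize (Hn n (le_n n)); specialize (K n).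
assert (Pg : 0 < Cmod (g z') ^ n) by (apply pow_lt; lra).
rewrite Rabs_pos_eq in Hn by (apply pow_le, Rdiv_le_0_compat; lra).
unfold Rdiv in Hn at 1; rewrite Rpow_mult_distr, pow_inv in Hn.
apply (Rlt_div_r _ _ _ P2) in Hn.
apply Rmult_lt_compat_l with (1 := Pg) in Hn.
replace (Cmod (g z') ^ n * (m ^ n * / Cmod (g z') ^ n * 2 ^ length l))
  with (m ^ n * 2 ^ length l) in Hn by (field; lra).
lra.
Qed.

(** * Peak functions *)

(* For [Re z >= 0] the values of [a / (a + z)] lie in the disc with diameter
   [0, 1] and are near 0 or 1 unless [|z|] is comparable to [a].  Hence the
   average of [n] of these functions with scales [a / 2 ^ k] is within
   [O (1 / n)] of the segment [0, 1]. *)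
Fixpoint peak_sum (n : nat) (a : R) (z : C) : C :=
  match n with
  | O => 0%C
  | S n => (RtoC a * / (RtoC a + z) + peak_sum n (a / 2) z)%C
  end.

Lemma peak_den_neq_0 (a : R) (z : C) : 0 < a -> 0 <= fst z -> (RtoC a + z)%C <> 0%C.
Proof. intros Ha Hz E; apply (f_equal fst) in E; simpl in E; lra. Qed.

Lemma peak_sum_0 (n : nat) (a : R) : 0 < a -> peak_sum n a 0%C = RtoC (INR n).
Proof.
revert a; induction n as [|n IH]; intros a Ha; [reflexivity|].
rewrite S_INR, RtoC_plus; simpl peak_sum; rewrite IH by lra; field.
intros E; apply RtoC_inj in E; lra.
Qed.

(** With [z = p + i q] and [a, p >= 0], the squared denominator [(a + p) ^ 2 + q ^ 2] is at least
    [a ^ 2 + |z| ^ 2]. *)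
Lemma peak_term_bounds (a : R) (z : C) : 0 < a -> 0 <= fst z ->
  0 <= fst (RtoC a * / (RtoC a + z))%C <= 1 /\
  Rabs (snd (RtoC a * / (RtoC a + z))%C) <= a * Cmod z / (a ^ 2 + Cmod z ^ 2).
Proof.
intros Ha Hz.
assert (X := Cmod2_alt z); assert (Y := abs_snd_le_Cmod z).
unfold Re, Im in X; set (x := Cmod z) in *.
destruct z as [p q]; simpl fst in Hz, X; simpl snd in X, Y.
set (D := (a + p) ^ 2 + q ^ 2).
assert (HD : a ^ 2 + x ^ 2 <= D) by (rewrite X; unfold D; nra).
assert (Ha2 : 0 < a ^ 2) by (apply pow_lt; exact Ha).
assert (Hx2 : 0 <= x ^ 2) by (apply pow2_ge_0).
assert (E1 : fst (RtoC a * / (RtoC a + (p, q)))%C = a * (a + p) / D).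
{ unfold D in *; simpl; field; nra. }
assert (E2 : snd (RtoC a * / (RtoC a + (p, q)))%C = - (a * q / D)).
{ unfold D in *; simpl; field; nra. }
rewrite E1, E2; split; [split|].
- apply Rdiv_le_0_compat; [apply Rmult_le_pos; lra|lra].
- apply Rle_div_l; [lra|]; unfold D; nra.
- rewrite Rabs_Ropp; unfold Rdiv; rewrite !Rabs_mult, Rabs_inv, (Rabs_pos_eq a), (Rabs_pos_eq D) by lra.
  apply Rmult_le_compat.
  + apply Rmult_le_pos; [lra|apply Rabs_pos].
  + left; apply Rinv_0_lt_compat; lra.
  + apply Rmult_le_compat_l; lra.
  + apply Rinv_le_contravar; lra.
Qed.

Lemma peak_sum_fst (n : nat) (a : R) (z : C) : 0 < a -> 0 <= fst z ->
  0 <= fst (peak_sum n a z) <= INR n.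
Proof.
revert a; induction n as [|n IH]; intros a Ha Hz; [simpl; lra|].
rewrite S_INR; destruct (peak_term_bounds a z Ha Hz) as [K _].
specialize (IH (a / 2) ltac:(lra) Hz).
change (fst (peak_sum (S n) a z)) with (fst (RtoC a * / (RtoC a + z))%C + fst (peak_sum n (a / 2) z)).
lra.
Qed.

(** Telescoping: the imaginary part of each term is at most the drop of [4 a / (a + |z|)] when [a]
    is halved. The total is thus bounded independently of [n]. *)
Lemma peak_sum_snd (n : nat) (a : R) (z : C) : 0 < a -> 0 <= fst z ->
  Rabs (snd (peak_sum n a z)) <= 4 * (a / (a + Cmod z)).
Proof.
revert a; induction n as [|n IH]; intros a Ha Hz; assert (X := Cmod_ge_0 z).
- simpl; rewrite Rabs_R0; apply Rmult_le_pos; [lra|apply Rdiv_le_0_compat; lra].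
- destruct (peak_term_bounds a z Ha Hz) as [_ K].
  specialize (IH (a / 2) ltac:(lra) Hz); set (x := Cmod z) in *.
  change (snd (peak_sum (S n) a z)) with (snd (RtoC a * / (RtoC a + z))%C + snd (peak_sum n (a / 2) z)).
  apply Rle_trans with (1 := Rabs_triang _ _).
  enough (a * x / (a ^ 2 + x ^ 2) <= 4 * (a / (a + x)) - 4 * (a / 2 / (a / 2 + x))) by lra.
  replace (4 * (a / (a + x)) - 4 * (a / 2 / (a / 2 + x)))
    with (a * x * (4 / ((a + x) * (a + 2 * x)))) by (field; lra).
  unfold Rdiv at 1; apply Rmult_le_compat_l; [apply Rmult_le_pos; lra|].
  apply Rle_div_r; [apply Rmult_lt_0_compat; lra|].
  rewrite Rmult_comm; apply Rle_div_l; [nra|].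
  assert (0 <= (a - x) ^ 2) by apply pow2_ge_0; nra.
Qed.

(** As [Re z >= 0], [|a + z| >= |z|], so each term times [|z|] is at most its own scale, hence at
    most the first one. *)
Lemma peak_sum_far (n : nat) (a : R) (z : C) : 0 < a -> 0 <= fst z ->
  Cmod z * Cmod (peak_sum n a z) <= INR n * a.
Proof.
revert a; induction n as [|n IH]; intros a Ha Hz.
- simpl; rewrite Cmod_0; lra.
- rewrite S_INR; specialize (IH (a / 2) ltac:(lra) Hz); simpl peak_sum.
  assert (N := pos_INR n); assert (X := Cmod_ge_0 z).
  assert (P := proj1 (Cmod_gt_0 _) (peak_den_neq_0 a z Ha Hz)).
  assert (K : Cmod z <= Cmod (RtoC a + z)).
  { apply Rsqr_incr_0_var; [|lra]; rewrite !Rsqr_pow2, !Cmod2_alt.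
    destruct z as [p q]; simpl in *; nra. }
  assert (T : Cmod z * Cmod (RtoC a * / (RtoC a + z)) <= a).
  { rewrite Cmod_mult, Cmod_R, Cmod_inv, Rabs_pos_eq by (lra || apply peak_den_neq_0; assumption).
    rewrite <- Rmult_assoc; apply Rle_div_l; [exact P|]; nra. }
  assert (Q := Cmod_triangle (RtoC a * / (RtoC a + z)) (peak_sum n (a / 2) z)).
  apply Rmult_le_compat_l with (1 := X) in Q; nra.
Qed.

(** The peak is the average of [peak_sum] in the variable [zeta = 1 - conj w z], which vanishes at
    [w], has modulus [|z - w|] and has nonnegative real part on the disc. Values near the segment
    from 0 to 1 make [|p| + |1 - p|] nearly 1. *)
Lemma exists_peak (w : C) (eps eta r : R) : unit_circle w -> 0 < eps -> 0 < eta -> 0 < r ->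
  exists p : C -> C, disc_holomorphic p /\ p w = 1%C /\
    (forall z, closed_disc z -> Cmod (p z) <= 1 + eps /\ Cmod (p z) + Cmod (1 - p z) <= 1 + eps) /\
    (forall z, closed_disc z -> r <= Cmod (z - w) -> Cmod (p z) <= eta).
Proof.
unfold unit_circle; intros Hw He Heta Hr.
(* The imaginary part of the sum is at most 4, so that of the average is at most [eps / 2]; it
   counts twice in [|p| + |1 - p|]. *)
destruct (archimed_cor1 (eps / 8) ltac:(lra)) as [n [Hn Hn0]].
assert (N := lt_0_INR n Hn0).
(* At distance [r] from [w] the average is at most [a / r], that is [eta]. *)
set (a := eta * r); assert (Ha : 0 < a) by (apply Rmult_lt_0_compat; assumption).
set (zeta := fun z => (1 - Cconj w * z)%C).
assert (Eww : (Cconj w * w)%C = 1%C) by (rewrite Cmult_comm, <- Cmod2_conj, Hw; f_equal; ring).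
assert (Hzeta : forall z, Cmod (zeta z) = Cmod (z - w)).
{ intros z; unfold zeta; rewrite <- Eww.
  replace (Cconj w * w - Cconj w * z)%C with (Cconj w * (w - z))%C by ring.
  rewrite Cmod_mult, Cmod_conj, Hw, Cmod_minus_sym; ring. }
assert (Hre : forall z, closed_disc z -> 0 <= fst (zeta z)).
{ intros z Hz; unfold closed_disc in Hz.
  assert (K := abs_fst_le_Cmod (Cconj w * z)).
  rewrite Cmod_mult, Cmod_conj, Hw, Rmult_1_l in K.
  assert (K2 := Rle_abs (fst (Cconj w * z)%C)).
  change (0 <= 1 - fst (Cconj w * z)%C); lra. }
assert (Ninv : RtoC (INR n) <> 0%C) by (intros E; apply RtoC_inj in E; lra).
exists (fun z => (RtoC (/ INR n) * peak_sum n a (zeta z))%C); split; [|split; [|split]].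
- apply disc_holomorphic_mult; [apply disc_holomorphic_const|].
  assert (Hz : disc_holomorphic zeta).
  { apply disc_holomorphic_minus; [apply disc_holomorphic_const|].
    apply disc_holomorphic_mult; [apply disc_holomorphic_const|apply disc_holomorphic_id]. }
  clearbody a; clear - Ha Hz Hre; revert a Ha; induction n as [|n IH]; intros a Ha; simpl.
  + apply disc_holomorphic_const.
  + apply disc_holomorphic_plus; [|apply IH; lra].
    apply disc_holomorphic_mult; [apply disc_holomorphic_const|].
    apply disc_holomorphic_inv.
    * apply disc_holomorphic_plus; [apply disc_holomorphic_const|exact Hz].
    * intros z Hz'; apply peak_den_neq_0; auto.
- replace (zeta w) with (RtoC 0) by (unfold zeta; rewrite Eww; ring).
  rewrite peak_sum_0 by exact Ha; rewrite <- RtoC_mult; f_equal; field; lra.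
- intros z Hz.
  set (s := peak_sum n a (zeta z)).
  assert (K1 := peak_sum_fst n a (zeta z) Ha (Hre z Hz)).
  assert (K2 := peak_sum_snd n a (zeta z) Ha (Hre z Hz)).
  fold s in K1, K2.
  assert (K3 : Rabs (snd s) <= 4).
  { apply Rle_trans with (1 := K2); assert (X := Cmod_ge_0 (zeta z)).
    assert (a / (a + Cmod (zeta z)) <= 1) by (apply Rle_div_l; lra); lra. }
  set (p := (RtoC (/ INR n) * s)%C).
  assert (E1 : fst p = fst s / INR n) by (unfold p; simpl; field; lra).
  assert (E2 : snd p = snd s / INR n) by (unfold p; simpl; field; lra).
  assert (F1 : 0 <= fst p <= 1).
  { rewrite E1; split; [apply Rdiv_le_0_compat; lra|apply Rle_div_l; lra]. }
  assert (F2 : Rabs (snd p) <= eps / 2).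
  { rewrite E2; unfold Rdiv; rewrite Rabs_mult, Rabs_inv, (Rabs_pos_eq (INR n)) by lra.
    apply Rle_trans with (4 * (eps / 8)); [|lra].
    apply Rmult_le_compat; [apply Rabs_pos|left; apply Rinv_0_lt_compat, N|exact K3|lra]. }
  assert (G1 := Cmod_le_abs_sum p); assert (G2 := Cmod_le_abs_sum (1 - p)).
  replace (fst (1 - p)%C) with (1 - fst p) in G2 by reflexivity.
  replace (snd (1 - p)%C) with (- snd p) in G2 by (simpl; ring).
  rewrite Rabs_Ropp, (Rabs_pos_eq (1 - fst p)) in G2 by lra.
  rewrite (Rabs_pos_eq (fst p)) in G1 by lra.
  split; lra.
- intros z Hz Hzr.
  assert (K := peak_sum_far n a (zeta z) Ha (Hre z Hz)); rewrite Hzeta in K.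
  rewrite Cmod_mult, Cmod_R, Rabs_pos_eq by (left; apply Rinv_0_lt_compat, N).
  set (t := Cmod (peak_sum n a (zeta z))) in *.
  assert (T : 0 <= t) by apply Cmod_ge_0.
  rewrite Rmult_comm; apply Rle_div_l; [exact N|].
  apply Rmult_le_reg_l with r; [exact Hr|].
  apply Rle_trans with (Cmod (z - w) * t); [apply Rmult_le_compat_r; assumption|].
  unfold a in K; lra.
Qed.

(** * Operator norms *)

Section OperatorNorm.
Context {K : AbsRing} {X Y : NormedModule K}.

(** [real] sends an infinite bound to 0, so [op_norm] is the true supremum only once the set is
    known to be bounded. *)
Lemma op_norm_lub (T : X -> Y) (B : R) : (forall x, norm x <= 1 -> norm (T x) <= B) ->
  is_lub_Rbar (fun r => exists x : X, norm x <= 1 /\ r = norm (T x)) (Finite (op_norm T)).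
Proof.
intros HB; unfold op_norm.
assert (H := Lub_Rbar_correct (fun r => exists x : X, norm x <= 1 /\ r = norm (T x))).
destruct (Lub_Rbar _) as [l| |]; [exact H| |]; destruct H as [H1 H2]; exfalso.
- apply (H2 (Finite B)); intros r [x [Hx ->]]; apply HB, Hx.
- apply (H1 (norm (T zero))); exists zero; split; [rewrite norm_zero; lra|reflexivity].
Qed.

Lemma op_norm_le (T : X -> Y) (B : R) : (forall x, norm x <= 1 -> norm (T x) <= B) ->
  op_norm T <= B.
Proof.
intros HB; apply (proj2 (op_norm_lub T B HB) (Finite B)).
intros r [x [Hx ->]]; apply HB, Hx.
Qed.

Lemma is_linear_bounded (T : X -> Y) : is_linear T ->
  exists B, forall x, norm x <= 1 -> norm (T x) <= B.
Proof.
intros HT; destruct (linear_norm _ HT) as [B [HB0 HB]]; exists B; intros x Hx.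
apply Rle_trans with (1 := HB x); generalize (norm_ge_0 x); nra.
Qed.

Lemma le_op_norm (T : X -> Y) (x : X) : is_linear T -> norm x <= 1 -> norm (T x) <= op_norm T.
Proof.
intros HT Hx; destruct (is_linear_bounded T HT) as [B HB].
apply (op_norm_lub T B HB); exists x; auto.
Qed.

Lemma op_norm_approx (T : X -> Y) (m : R) : is_linear T -> m < op_norm T ->
  exists x, norm x <= 1 /\ m < norm (T x).
Proof.
intros HT Hm; destruct (is_linear_bounded T HT) as [B HB].
apply NNPP; intros Hno; apply (Rlt_not_le _ _ Hm).
apply (proj2 (op_norm_lub T B HB) (Finite m)); intros r [x [Hx ->]].
apply Rnot_lt_le; intros Hlt; apply Hno; exists x; auto.
Qed.

Lemma is_linear_fun_plus (S T : X -> Y) : is_linear S -> is_linear T ->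
  is_linear (fun x => plus (S x) (T x)).
Proof.
intros HS HT; split.
- intros x y; rewrite (linear_plus _ HS), (linear_plus _ HT), <- !plus_assoc; f_equal.
  rewrite !plus_assoc; f_equal; apply plus_comm.
- intros k x; rewrite (linear_scal _ HS), (linear_scal _ HT); symmetry.
  apply (scal_distr_l (V := NormedModule.ModuleSpace K Y)).
- destruct (linear_norm _ HS) as [A [A0 HA]], (linear_norm _ HT) as [B [B0 HB]].
  exists (A + B); split; [lra|]; intros x.
  apply Rle_trans with (1 := norm_triangle _ _).
  rewrite Rmult_plus_distr_r; apply Rplus_le_compat; auto.
Qed.

End OperatorNorm.

(** * The sup norm and continuity in the disc algebra *)

Lemma sup_norm_approx (f : disc_algebra) (m : R) : m < sup_norm f ->
  exists z, open_disc z /\ m < Cmod (f z).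
Proof.
intros Hm; apply NNPP; intros Hno; apply (Rlt_not_le _ _ Hm), sup_norm_le; intros z Hz.
apply Rnot_lt_le; intros Hlt; apply Hno; exists z; auto.
Qed.

Lemma le_sup_norm_closed (f : disc_algebra) (z : C) : closed_disc z -> Cmod (f z) <= sup_norm f.
Proof. apply da_closed_bound, le_sup_norm. Qed.

Lemma sup_norm_ge_0 (f : disc_algebra) : 0 <= sup_norm f.
Proof.
apply Rle_trans with (1 := Cmod_ge_0 (f 0%C)), le_sup_norm.
unfold open_disc; rewrite Cmod_0; lra.
Qed.

Lemma sup_norm_pos (f : disc_algebra) : f <> zero -> 0 < sup_norm f.
Proof.
intros Hf; destruct (sup_norm_ge_0 f) as [Hlt|E]; [exact Hlt|].
exfalso; apply Hf, sup_norm_eq0; symmetry; exact E.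
Qed.

Lemma da_continuity (f : disc_algebra) (z : C) (eps : R) : closed_disc z -> 0 < eps ->
  exists d, 0 < d /\ forall w, closed_disc w -> Cmod (w - z) < d -> Cmod (f w - f z) < eps.
Proof. intros Hz He; apply (proj1 (continuous_on_C _ _) (proj2 (da_holomorphic f)) z Hz eps He). Qed.

Lemma da_const_exists (c : C) : exists f : disc_algebra, forall z, closed_disc z -> f z = c.
Proof. apply (da_exists (fun _ => c)), disc_holomorphic_const. Qed.

Lemma disc_self_map_closed (phi : disc_algebra) (z : C) :
  disc_self_map phi -> closed_disc z -> closed_disc (phi z).
Proof. intros H; apply (da_closed_bound phi 1); intros w Hw; left; apply H, Hw. Qed.

(** * Necessity *)

Lemma rank_one_eval (w0 kappa : C) (y : disc_algebra) :
  open_disc w0 -> kappa <> 0%C -> y <> zero ->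
  rank_one (fun f : disc_algebra => scal (kappa * f w0)%C y).
Proof.
intros Hw0 Hk Hy; split.
- split.
  + intros f g; rewrite <- (scal_distr_r (V := da_ModuleSpace)); f_equal.
    apply Cmult_plus_distr_l.
  + intros c f; rewrite (scal_assoc (V := da_ModuleSpace)); f_equal.
    change (kappa * (c * f w0) = c * (kappa * f w0))%C; ring.
  + assert (K1 := Cmod_ge_0 kappa); assert (K2 := sup_norm_ge_0 y).
    exists (Cmod kappa * sup_norm y + 1); split; [nra|].
    intros f; apply Rle_trans with (1 := sup_norm_scal _ _).
    change (Cmod (kappa * f w0) * sup_norm y <= (Cmod kappa * sup_norm y + 1) * sup_norm f).
    rewrite Cmod_mult; assert (K3 := le_sup_norm f w0 Hw0); assert (K4 := Cmod_ge_0 (f w0)).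
    assert (K5 : 0 <= Cmod kappa * sup_norm y) by (apply Rmult_le_pos; assumption).
    nra.
- exists y; split; [exact Hy|]; intros v; split; intros [c <-] || intros [c ->].
  + exists (kappa * c w0)%C; reflexivity.
  + destruct (da_const_exists (c / kappa)%C) as [f Hf]; exists f; rewrite Hf by (left; exact Hw0).
    f_equal; field; exact Hk.
Qed.

(** If [|1 + z| / 2] is nearly 1 then [|1 - z|] is small, which localizes the points where the test
    function nearly peaks. *)
Lemma parallelogram_unit (z : C) : closed_disc z ->
  Cmod (1 - z) ^ 2 + Cmod (1 + z) ^ 2 <= 4.
Proof.
unfold closed_disc; intros Hz; assert (K := Cmod_ge_0 z).
assert (K2 : Cmod z ^ 2 <= 1) by (simpl; nra).
rewrite !Cmod2_alt in *; destruct z as [p q]; simpl in *; nra.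
Qed.

(* The rank-one operator tested is [f |-> kappa f(w0) y], where
   [y = (1 + conj z0 z) / 2] peaks at [z0]. *)
Lemma Daugavet_center_witness (phi u : disc_algebra) (Hphi : disc_self_map phi)
  (z0 w0 kappa : C) (eps : R) :
  Daugavet_center (weighted_comp u phi Hphi) ->
  unit_circle z0 -> open_disc w0 -> kappa <> 0%C -> 0 < eps ->
  exists (f : disc_algebra) (z b : C), (forall x, closed_disc x -> Cmod (f x) <= 1) /\
    closed_disc z /\ Cmod (z - z0) < eps /\ Cmod b <= 1 /\ Cmod (1 - b) < eps /\
    sup_norm u + Cmod kappa - eps < Cmod (u z * f (phi z) + kappa * f w0 * b).
Proof.
intros [HG HD] Hz0 Hw0 Hk He.
assert (Kk := proj1 (Cmod_gt_0 kappa) Hk).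
set (yf := fun z => (RtoC (/ 2) * (1 + Cconj z0 * z))%C).
destruct (da_exists yf) as [y Hy].
{ apply disc_holomorphic_mult; [apply disc_holomorphic_const|].
  apply disc_holomorphic_plus; [apply disc_holomorphic_const|].
  apply disc_holomorphic_mult; [apply disc_holomorphic_const|apply disc_holomorphic_id]. }
assert (Hzz : (Cconj z0 * z0)%C = 1%C)
  by (rewrite Cmult_comm, <- Cmod2_conj, Hz0; f_equal; ring).
assert (Hz0c : closed_disc z0) by (right; exact Hz0).
assert (Hy0 : y z0 = 1%C).
{ rewrite Hy by exact Hz0c; unfold yf; rewrite Hzz, <- !RtoC_plus, <- RtoC_mult; f_equal; field. }
assert (Hyn : y <> zero).
{ intros E; rewrite E in Hy0; change (RtoC 0 = RtoC 1) in Hy0; apply RtoC_inj in Hy0; lra. }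
set (T := fun f : disc_algebra => scal (kappa * f w0)%C y : disc_algebra).
assert (HT : rank_one T) by (apply rank_one_eval; assumption).
destruct (da_const_exists 1%C) as [one Hone].
assert (Hone1 : sup_norm one <= 1).
{ apply sup_norm_le; intros z Hz; rewrite Hone by (left; exact Hz); rewrite Cmod_1; lra. }
assert (NG : sup_norm u <= op_norm (weighted_comp u phi Hphi)).
{ apply Rle_trans with (2 := le_op_norm _ one HG Hone1), sup_norm_le; intros z Hz.
  apply Rle_trans with (2 := le_sup_norm _ z Hz); simpl.
  rewrite Hone by (left; apply Hphi, Hz); rewrite Cmult_1_r; lra. }
assert (NT : Cmod kappa <= op_norm T).
{ apply Rle_trans with (2 := le_op_norm _ one (proj1 HT) Hone1).
  apply Rle_trans with (2 := le_sup_norm_closed _ z0 Hz0c).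
  change (Cmod kappa <= Cmod (kappa * one w0 * y z0)).
  rewrite Hy0, Hone by (left; exact Hw0); rewrite !Cmult_1_r; lra. }
(* The tolerance is quadratic in [eps]: [1 - |y z| < eps ^ 2 / 16] gives
   [|z - z0| ^ 2 <= 8 (1 - |y z|) < eps ^ 2]. *)
set (e := Rmin eps (Cmod kappa * eps ^ 2 / 16)).
assert (He0 : 0 < e).
{ apply Rmin_pos; [exact He|]; generalize (Rmult_lt_0_compat _ _ Kk (pow_lt _ 2 He)); lra. }
assert (He1 : e <= eps) by apply Rmin_l.
assert (He2 : e <= Cmod kappa * eps ^ 2 / 16) by apply Rmin_r.
destruct (op_norm_approx (X := da_NormedModule) (Y := da_NormedModule)
  (fun x => plus (weighted_comp u phi Hphi x) (T x))
  (sup_norm u + Cmod kappa - e)) as [f [Hf1 Hf2]].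
{ exact (is_linear_fun_plus (X := da_NormedModule) (Y := da_NormedModule) _ _ HG (proj1 HT)). }
{ apply Rlt_le_trans with (op_norm (weighted_comp u phi Hphi) + op_norm T); [lra|].
  right; symmetry; exact (HD T HT). }
destruct (sup_norm_approx _ _ Hf2) as [z [Hz Hlt]].
assert (Hzc : closed_disc z) by (left; exact Hz).
change (sup_norm u + Cmod kappa - e < Cmod (u z * f (phi z) + kappa * f w0 * y z)) in Hlt.
assert (Hf : forall x, closed_disc x -> Cmod (f x) <= 1).
{ intros x Hx; apply Rle_trans with (1 := le_sup_norm_closed f x Hx), Hf1. }
exists f, z, (y z).
set (v := (Cconj z0 * z)%C).
assert (Hv : closed_disc v).
{ unfold closed_disc, v; rewrite Cmod_mult, Cmod_conj, Hz0, Rmult_1_l; exact Hzc. }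
assert (Nv : Cmod (1 - v) = Cmod (z - z0)).
{ unfold v; rewrite <- Hzz.
  replace (Cconj z0 * z0 - Cconj z0 * z)%C with (Cconj z0 * (z0 - z))%C by ring.
  rewrite Cmod_mult, Cmod_conj, Hz0, Cmod_minus_sym; ring. }
assert (Ey : y z = (RtoC (/ 2) * (1 + v))%C) by (apply Hy, Hzc).
assert (Ny : Cmod (y z) = Cmod (1 + v) / 2).
{ rewrite Ey, Cmod_mult, Cmod_R, Rabs_pos_eq by lra; field. }
assert (N1y : Cmod (1 - y z) = Cmod (z - z0) / 2).
{ rewrite <- Nv, Ey.
  replace (1 - RtoC (/ 2) * (1 + v))%C with (RtoC (/ 2) * (1 - v))%C.
  - rewrite Cmod_mult, Cmod_R, Rabs_pos_eq by lra; field.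
  - replace (RtoC 1) with (RtoC (/ 2) + RtoC (/ 2))%C at 2
      by (rewrite <- RtoC_plus; f_equal; field).
    ring. }
assert (P := parallelogram_unit v Hv); rewrite Nv in P.
assert (V0 := Cmod_ge_0 (1 + v)); assert (Z0 := Cmod_ge_0 (z - z0)).
assert (Hy1 : Cmod (y z) <= 1) by (rewrite Ny; simpl in P; nra).
(* All factors other than [y z] are replaced by their maximal moduli, so near-extremality forces
   [|y z|] close to 1. *)
assert (Hlow : Cmod kappa * (1 - Cmod (y z)) < e).
{ assert (Q := Rlt_le_trans _ _ _ Hlt (Cmod_triangle _ _)).
  rewrite !Cmod_mult in Q.
  assert (Q1 := le_sup_norm u z Hz).
  assert (Q2 := Hf (phi z) (disc_self_map_closed phi z Hphi Hzc)).
  assert (Q3 := Hf w0 (Rlt_le _ _ Hw0)).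
  assert (U0 := Cmod_ge_0 (u z)); assert (Y0 := Cmod_ge_0 (y z)).
  assert (Cmod (u z) * Cmod (f (phi z)) <= Cmod (u z) * 1) by (apply Rmult_le_compat_l; lra).
  assert (Cmod kappa * Cmod (f w0) * Cmod (y z) <= Cmod kappa * 1 * Cmod (y z)).
  { apply Rmult_le_compat_r; [lra|]; apply Rmult_le_compat_l; lra. }
  lra. }
assert (Hdist : Cmod (z - z0) < eps).
{ assert (S1 : 1 - Cmod (y z) < eps ^ 2 / 16).
  { apply Rmult_lt_reg_l with (1 := Kk); lra. }
  rewrite Ny in S1, Hy1; apply Rnot_le_lt; intros Hle.
  assert (eps ^ 2 <= Cmod (z - z0) ^ 2) by (apply pow_incr; lra).
  simpl in *; nra. }
repeat split; auto; lra.
Qed.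

(** Taking [w0 = 0] and [kappa = 1] in the witness, the rank-one term contributes at most 1. Hence
    [|u|] exceeds [||u|| - eps] at a point near [z0], and continuity costs another [eps]. *)
Lemma Daugavet_center_Cmod_weight (phi u : disc_algebra) (Hphi : disc_self_map phi) (z0 : C) :
  Daugavet_center (weighted_comp u phi Hphi) -> unit_circle z0 -> Cmod (u z0) = sup_norm u.
Proof.
intros HD Hz0; assert (Hz0c : closed_disc z0) by (right; exact Hz0).
apply Rle_antisym; [apply le_sup_norm_closed, Hz0c|].
apply le_of_le_plus_eps with (c := 2); intros eps He.
destruct (da_continuity u z0 eps Hz0c He) as [d [d0 Hd]].
destruct (Daugavet_center_witness phi u Hphi z0 0%C 1%C (Rmin eps d)) as [f [z [b H]]];
  [exact HD|exact Hz0| | |apply Rmin_pos; assumption|].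
{ unfold open_disc; rewrite Cmod_0; lra. }
{ intros E; apply RtoC_inj in E; lra. }
destruct H as [Hf [Hz [Hzz [Hb [_ Hlt]]]]].
apply Rmin_Rgt_l in Hzz; destruct Hzz as [_ Hzd].
specialize (Hd z Hz Hzd).
assert (Q := Rlt_le_trans _ _ _ Hlt (Cmod_triangle _ _)).
rewrite !Cmod_mult, Cmod_1, Rmult_1_l in Q.
assert (Hm := Rmin_l eps d).
assert (Q2 := Hf (phi z) (disc_self_map_closed phi z Hphi Hz)).
assert (Q3 : Cmod (f 0%C) <= 1) by (apply Hf; unfold closed_disc; rewrite Cmod_0; lra).
assert (K1 : Cmod (u z) * Cmod (f (phi z)) <= Cmod (u z) * 1)
  by (apply Rmult_le_compat_l; [apply Cmod_ge_0|exact Q2]).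
assert (K2 : Cmod (f 0%C) * Cmod b <= 1 * 1)
  by (apply Rmult_le_compat; auto using Cmod_ge_0).
assert (K3 := Cmod_triangle (u z - u z0) (u z0)).
replace (u z - u z0 + u z0)%C with (u z) in K3 by ring.
lra.
Qed.

(* With [w0 = phi z0] inside the disc and [kappa = - u z0], equicontinuity of the
   unit ball near [w0] makes [u f(phi) - u(z0) f(w0) y] small near [z0]. *)
Lemma Daugavet_center_inner_symbol (phi u : disc_algebra) (Hphi : disc_self_map phi) :
  Daugavet_center (weighted_comp u phi Hphi) -> u <> zero -> inner phi.
Proof.
intros HD Hu z0 Hz0; assert (Hz0c : closed_disc z0) by (right; exact Hz0).
destruct (disc_self_map_closed phi z0 Hphi Hz0c) as [Hw0|E]; [exfalso|exact E].
assert (Eu := Daugavet_center_Cmod_weight phi u Hphi z0 HD Hz0); set (c := sup_norm u) in *.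
assert (Hc : 0 < c) by apply (sup_norm_pos _ Hu).
set (w0 := phi z0) in *.
destruct (da_continuity u z0 (c / 8) Hz0c ltac:(lra)) as [d1 [D1 Hd1]].
(* With 256, [bounded_holder_half] gives [|f (phi z) - f w0| ^ 2 <= 1 / 64]. *)
destruct (da_continuity phi z0 ((1 - Cmod w0) / 256) Hz0c ltac:(lra)) as [d2 [D2 Hd2]].
set (eps := Rmin (Rmin (c / 8) (1 / 8)) (Rmin d1 d2)).
destruct (Daugavet_center_witness phi u Hphi z0 w0 (- u z0)%C eps) as [f [z [b H]]].
{ exact HD. }
{ exact Hz0. }
{ exact Hw0. }
{ apply Cmod_gt_0; rewrite Cmod_opp; lra. }
{ repeat apply Rmin_pos; lra. }
destruct H as [Hf [Hz [Hzz [Hb [Hb1 Hlt]]]]].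
apply Rmin_Rgt_l in Hzz; destruct Hzz as [_ Hzd].
apply Rmin_Rgt_l in Hzd; destruct Hzd as [Hzd1 Hzd2].
apply Rmin_Rgt_l in Hb1; destruct Hb1 as [Hb1 _].
apply Rmin_Rgt_l in Hb1; destruct Hb1 as [_ Hb1].
assert (Hec : eps <= c / 8).
{ apply Rle_trans with (1 := Rmin_l _ _), Rmin_l. }
specialize (Hd1 z Hz Hzd1); specialize (Hd2 z Hz Hzd2); fold w0 in Hd2.
assert (Hpz := disc_self_map_closed phi z Hphi Hz).
assert (Hh := bounded_holder_half f w0 (phi z) (da_holomorphic f) Hf Hw0 Hpz).
assert (Hh' : Cmod (f (phi z) - f w0) <= 1 / 8).
{ assert (K := Cmod_ge_0 (f (phi z) - f w0)).
  apply Rnot_lt_le; intros K2; assert (1 / 64 < Cmod (f (phi z) - f w0) ^ 2) by (simpl; nra).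
  nra. }
rewrite Cmod_opp, Eu in Hlt; fold c in Hlt.
(* Each of the three terms has modulus at most [c / 8], whereas [Hlt] requires more than
   [2 c - c / 8]. *)
replace (u z * f (phi z) + - u z0 * f w0 * b)%C
  with ((u z - u z0) * f (phi z) + (u z0 * (f (phi z) - f w0) + u z0 * (f w0 * (1 - b))))%C
  in Hlt by ring.
assert (Q1 := Cmod_triangle ((u z - u z0) * f (phi z))
  (u z0 * (f (phi z) - f w0) + u z0 * (f w0 * (1 - b)))).
assert (Q2 := Cmod_triangle (u z0 * (f (phi z) - f w0)) (u z0 * (f w0 * (1 - b)))).
rewrite Cmod_mult in Q1.
rewrite !Cmod_mult, Eu in Q2.
assert (R1 : Cmod (u z - u z0) * Cmod (f (phi z)) <= c / 8 * 1)
  by (apply Rmult_le_compat; try apply Cmod_ge_0; [lra|auto]).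
assert (R2 : c * Cmod (f (phi z) - f w0) <= c * (1 / 8)) by (apply Rmult_le_compat_l; lra).
assert (R3 : c * (Cmod (f w0) * Cmod (1 - b)) <= c * (1 * (1 / 8))).
{ apply Rmult_le_compat_l; [lra|]; apply Rmult_le_compat; try apply Cmod_ge_0; [|lra].
  apply Hf; left; exact Hw0. }
lra.
Qed.

(** * Sufficiency *)

Lemma weighted_comp_linear (u phi : disc_algebra) (Hphi : disc_self_map phi) :
  is_linear (weighted_comp u phi Hphi).
Proof.
split.
- intros f g; apply da_eq; intros z.
  change (u z * (f (phi z) + g (phi z)) = u z * f (phi z) + u z * g (phi z))%C; ring.
- intros c f; apply da_eq; intros z.
  change (u z * (c * f (phi z)) = c * (u z * f (phi z)))%C; ring.
- assert (U := sup_norm_ge_0 u); exists (sup_norm u + 1); split; [lra|]; intros f.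
  assert (F := sup_norm_ge_0 f).
  apply sup_norm_le; intros z Hz; simpl; rewrite Cmod_mult.
  apply Rle_trans with (sup_norm u * sup_norm f); [|change (norm f) with (sup_norm f); nra].
  apply Rmult_le_compat; try apply Cmod_ge_0; apply le_sup_norm; auto.
Qed.

Lemma op_norm_scale (A : da_NormedModule -> da_NormedModule) (f : disc_algebra) (t : R) :
  is_linear A -> 0 < t -> sup_norm f <= t -> sup_norm (A f) <= t * op_norm A.
Proof.
intros HA Ht Hf.
set (x := scal (RtoC (/ t)) f : disc_algebra).
assert (Hinv : 0 < / t) by (apply Rinv_0_lt_compat, Ht).
assert (Hx : norm x <= 1).
{ apply Rle_trans with (1 := sup_norm_scal _ _).
  change (Cmod (RtoC (/ t)) * sup_norm f <= 1); rewrite Cmod_R, Rabs_pos_eq by lra.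
  rewrite Rmult_comm; apply Rle_div_l; lra. }
assert (E : A f = scal (RtoC t) (A x)).
{ rewrite <- (linear_scal _ HA); f_equal; apply da_eq; intros z.
  change (f z = (RtoC t * (RtoC (/ t) * f z))%C).
  rewrite Cmult_assoc, <- RtoC_mult, Rinv_r, Cmult_1_l by lra; reflexivity. }
rewrite E; apply Rle_trans with (1 := sup_norm_scal _ _).
change (Cmod (RtoC t) * sup_norm (A x) <= t * op_norm A); rewrite Cmod_R, Rabs_pos_eq by lra.
apply Rmult_le_compat_l; [lra|]; exact (le_op_norm A x HA Hx).
Qed.

(** The coefficient of [T f] on the line through [y] is read off by evaluating at a point [z0] with
    [y z0] nonzero, which is a linear and bounded operation. *)
Lemma rank_one_functional (T : da_NormedModule -> da_NormedModule) : rank_one T ->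
  exists (y : disc_algebra) (xi : disc_algebra -> C) (B : R),
    (forall f z, T f z = (xi f * y z)%C) /\
    (forall f g, xi (plus f g) = (xi f + xi g)%C) /\
    (forall (c : C) f, xi (scal c f) = (c * xi f)%C) /\
    0 < B /\ forall f, Cmod (xi f) <= B * sup_norm f.
Proof.
intros [HT [y [Hy Hrange]]].
assert (Ny : 0 < sup_norm y) by apply (sup_norm_pos _ Hy).
destruct (sup_norm_approx y 0 Ny) as [z0 [Hz0 Py]].
assert (Hy0 := proj2 (Cmod_gt_0 _) Py).
destruct (linear_norm _ HT) as [M [M0 HM]].
exists y, (fun f => T f z0 / y z0)%C, (M / Cmod (y z0)); repeat split.
- intros f z; destruct (proj1 (Hrange (T f)) (ex_intro _ f eq_refl)) as [c Hc].
  rewrite Hc; change (c * y z = c * y z0 / y z0 * y z)%C; field; exact Hy0.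
- intros f g; rewrite (linear_plus _ HT).
  change ((T f z0 + T g z0) / y z0 = T f z0 / y z0 + T g z0 / y z0)%C; field; exact Hy0.
- intros c f; rewrite (linear_scal _ HT).
  change (c * T f z0 / y z0 = c * (T f z0 / y z0))%C; field; exact Hy0.
- apply Rdiv_lt_0_compat; assumption.
- intros f; rewrite Cmod_div by exact Hy0.
  unfold Rdiv; rewrite Rmult_assoc, (Rmult_comm (/ _)), <- Rmult_assoc.
  apply Rmult_le_compat_r; [left; apply Rinv_0_lt_compat, Py|].
  apply Rle_trans with (2 := HM f), le_sup_norm, Hz0.
Qed.

(** * Bumps with separated peaks *)

Lemma positive_separation (w : C) (l : list C) : ~ In w l ->
  exists r, 0 < r /\ forall w', In w' l -> r <= Cmod (w - w').
Proof.
induction l as [|w0 l IH]; intros Hw.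
- exists 1; split; [lra|]; intros w' [].
- destruct IH as [r [r0 Hr]]; [intros H; apply Hw; right; exact H|].
  assert (P : 0 < Cmod (w - w0)).
  { apply Cmod_gt_0; intros E; apply Hw; left.
    replace w with ((w - w0) + w0)%C by ring; rewrite E; ring. }
  exists (Rmin r (Cmod (w - w0))); split; [apply Rmin_pos; assumption|].
  intros w' [<-|Hw']; [apply Rmin_r|apply Rle_trans with (1 := Rmin_l _ _); auto].
Qed.

(** Induction on [n]: since [phi] is inner, the images chosen so far lie on the circle, so
    [boundary_point_avoiding] yields a point with a new image. Finitely many new distances allow a
    common positive [r]. *)
Lemma separated_boundary_points (phi g : disc_algebra) (m : R) (z' : C) (n : nat) :
  disc_self_map phi -> inner phi -> 0 <= m -> open_disc z' -> m < Cmod (g z') ->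
  exists (l : list C) (r : R), length l = n /\ 0 < r /\
    (forall z, In z l -> unit_circle z /\ m < Cmod (g z)) /\
    ForallOrdPairs (fun z w => r <= Cmod (phi z - phi w)) l.
Proof.
intros Hphi Hin Hm Hz' Hg; induction n as [|n [l [r [Hl [r0 [Hl2 Hsep]]]]]].
- exists nil, 1; split; [reflexivity|split; [lra|split; [intros z []|constructor]]].
- destruct (boundary_point_avoiding phi g (map phi l) m z') as [z [Hz [Hgz Hav]]]; try assumption.
  { intros c Hc; apply in_map_iff in Hc; destruct Hc as [w [<- Hw]].
    apply Hin, Hl2, Hw. }
  destruct (positive_separation (phi z) (map phi l) Hav) as [r' [r0' Hr']].
  exists (z :: l), (Rmin r r'); split; [simpl; rewrite Hl; reflexivity|].
  split; [apply Rmin_pos; assumption|split].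
  + intros w [<-|Hw]; auto.
  + constructor.
    * apply Forall_forall; intros w Hw; apply Rle_trans with (1 := Rmin_r _ _).
      apply Hr', in_map, Hw.
    * clear - Hsep; induction Hsep as [|w l Hw _ IH]; constructor; [|exact IH].
      revert Hw; apply Forall_impl; intros x Hx; apply Rle_trans with (1 := Rmin_l _ _), Hx.
Qed.

(** For a peak [p] at [w], take [h = p (lambda - f)]. Then [f + h = (1 - p) f + p lambda] has
    modulus at most [|1 - p| + |p|], and [|lambda - f| <= 2] accounts for [eta / 2] and 4. *)
Lemma exists_bump (f : disc_algebra) (w lambda : C) (eps eta r : R) :
  (forall x, closed_disc x -> Cmod (f x) <= 1) -> unit_circle w -> Cmod lambda = 1 ->
  0 < eps <= 1 -> 0 < eta -> 0 < r ->
  exists h : disc_algebra, h w = (lambda - f w)%C /\ forall x, closed_disc x ->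
    Cmod (f x + h x) <= 1 + eps /\ Cmod (h x) <= 4 /\ (r <= Cmod (x - w) -> Cmod (h x) <= eta).
Proof.
intros Hf Hw Hla He Heta Hr.
destruct (exists_peak w eps (eta / 2) r Hw ltac:(lra) ltac:(lra) Hr) as [p [P1 [P2 [P3 P4]]]].
destruct (da_exists (fun x => p x * (lambda - f x))%C) as [h Hh].
{ apply disc_holomorphic_mult; [exact P1|].
  apply disc_holomorphic_minus; [apply disc_holomorphic_const|apply da_holomorphic]. }
exists h; split; [rewrite Hh, P2 by (right; exact Hw); ring|].
intros x Hx; rewrite Hh by exact Hx; specialize (Hf x Hx); destruct (P3 x Hx) as [Q1 Q2].
assert (K : Cmod (lambda - f x) <= 2).
{ unfold Cminus; apply Rle_trans with (1 := Cmod_triangle _ _); rewrite Cmod_opp; lra. }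
assert (K1 := Cmod_ge_0 (p x)); assert (K2 := Cmod_ge_0 (lambda - f x)).
split; [|split].
- replace (f x + p x * (lambda - f x))%C with ((1 - p x) * f x + p x * lambda)%C by ring.
  apply Rle_trans with (1 := Cmod_triangle _ _); rewrite !Cmod_mult, Hla.
  assert (K3 := Cmod_ge_0 (1 - p x)); nra.
- rewrite Cmod_mult; nra.
- intros Hxw; specialize (P4 x Hx Hxw); rewrite Cmod_mult; nra.
Qed.

Definition sum_list (F : C -> R) (l : list C) : R := fold_right (fun z s => F z + s) 0 l.

Lemma sum_list_le_const (F : C -> R) (l : list C) (M : R) :
  (forall z, In z l -> F z <= M) -> sum_list F l <= INR (length l) * M.
Proof.
induction l as [|z l IH]; intros H; [simpl; lra|].
cbn [length sum_list fold_right]; rewrite S_INR; fold (sum_list F l).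
assert (H1 := H z (or_introl eq_refl)).
assert (H2 := IH (fun w Hw => H w (or_intror Hw))); lra.
Qed.

(* At most one bump is not small at [x]. *)
Lemma sum_separated_bumps (b : C -> C) (F : C -> R) (l : list C) (x : C) (r M eta : R) :
  0 <= M -> 0 <= eta ->
  (forall z, In z l -> F z <= M /\ (r / 2 <= Cmod (x - b z) -> F z <= eta)) ->
  ForallOrdPairs (fun z w => r <= Cmod (b z - b w)) l ->
  sum_list F l <= M + INR (length l) * eta.
Proof.
intros HM Heta HF Hsep; induction Hsep as [|z l Hz _ IH]; [simpl; lra|].
cbn [length sum_list fold_right]; rewrite S_INR; fold (sum_list F l).
destruct (HF z (or_introl eq_refl)) as [F1 F2].
destruct (Rle_lt_dec (r / 2) (Cmod (x - b z))) as [Hle|Hlt].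
- specialize (F2 Hle); specialize (IH (fun w Hw => HF w (or_intror Hw))); lra.
- assert (K : sum_list F l <= INR (length l) * eta).
  { apply sum_list_le_const; intros w Hw; apply HF; [right; exact Hw|].
    rewrite Forall_forall in Hz; specialize (Hz w Hw).
    assert (Q := Cmod_triangle (b z - x) (x - b w)).
    replace (b z - x + (x - b w))%C with (b z - b w)%C in Q by ring.
    rewrite (Cmod_minus_sym (b z) x) in Q; lra. }
  lra.
Qed.

(** Each [H z] is multiplied by a unimodular constant that makes its image under [xi] nonnegative;
    pointwise moduli do not change. *)
Lemma functional_abs_sum (xi : disc_algebra -> C) (H : C -> disc_algebra) (l : list C) :
  (forall f g, xi (plus f g) = (xi f + xi g)%C) ->
  (forall (c : C) f, xi (scal c f) = (c * xi f)%C) ->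
  exists F : disc_algebra, xi F = RtoC (sum_list (fun z => Cmod (xi (H z))) l) /\
    forall x, Cmod (F x) <= sum_list (fun z => Cmod (H z x)) l.
Proof.
intros Hplus Hscal; induction l as [|z l [F [F1 F2]]].
(* The zero function is written as a multiple so that homogeneity gives [xi F = 0]. *)
- exists (scal (RtoC 0) zero); split; [rewrite Hscal; simpl; ring|].
  intros x; change (Cmod (0 * 0) <= 0); rewrite Cmult_0_l, Cmod_0; lra.
- destruct (Cmod_unit_phase (xi (H z))) as [c [C1 C2]].
  exists (plus (scal c (H z)) F); split.
  + rewrite Hplus, Hscal, C2, F1, <- RtoC_plus; reflexivity.
  + intros x; change (Cmod (c * H z x + F x) <= Cmod (H z x) + sum_list (fun z => Cmod (H z x)) l).
    apply Rle_trans with (1 := Cmod_triangle _ _); rewrite Cmod_mult, C1, Rmult_1_l.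
    apply Rplus_le_compat_l, F2.
Qed.

Lemma sum_list_ge_const (F : C -> R) (l : list C) (e : R) :
  (forall z, In z l -> e <= F z) -> INR (length l) * e <= sum_list F l.
Proof.
induction l as [|z l IH]; intros H; [simpl; lra|].
cbn [length sum_list fold_right]; rewrite S_INR; fold (sum_list F l).
assert (H1 := H z (or_introl eq_refl)).
assert (H2 := IH (fun w Hw => H w (or_intror Hw))); lra.
Qed.

(** If [|xi|] were at least [e] on all of [n] separated bumps, their rephased sum would have norm at
    most 5 and image at least [n e], against the bound [B] on [xi]. *)
Lemma exists_small_bump (phi g f : disc_algebra) (xi : disc_algebra -> C) (lambda : C -> C)
  (B m e eps : R) (z' : C) :
  disc_self_map phi -> inner phi -> 0 <= m -> open_disc z' -> m < Cmod (g z') ->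
  (forall f g, xi (plus f g) = (xi f + xi g)%C) ->
  (forall (c : C) f, xi (scal c f) = (c * xi f)%C) ->
  0 < B -> (forall f, Cmod (xi f) <= B * sup_norm f) ->
  (forall x, closed_disc x -> Cmod (f x) <= 1) ->
  (forall z, unit_circle z -> m < Cmod (g z) -> Cmod (lambda z) = 1) ->
  0 < e -> 0 < eps <= 1 ->
  exists (z : C) (h : disc_algebra), unit_circle z /\ m < Cmod (g z) /\
    Cmod (xi h) < e /\ h (phi z) = (lambda z - f (phi z))%C /\
    forall x, closed_disc x -> Cmod (f x + h x) <= 1 + eps.
Proof.
intros Hphi Hin Hm Hz' Hg Hplus Hscal HB Hxi Hf Hla He Heps.
(* The 5 is 4 for the single bump that may be large at a given point, plus [n] tails of size
   [1 / n]. *)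
destruct (archimed_cor1 (e / (5 * B))) as [n [Hn Hn0]]; [apply Rdiv_lt_0_compat; lra|].
assert (N := lt_0_INR n Hn0).
destruct (separated_boundary_points phi g m z' n) as [l [r [Hl [r0 [Hl2 Hsep]]]]]; try assumption.
set (ok := fun z (h : disc_algebra) => h (phi z) = (lambda z - f (phi z))%C /\
  forall x, closed_disc x -> Cmod (f x + h x) <= 1 + eps /\ Cmod (h x) <= 4 /\
    (r / 2 <= Cmod (x - phi z) -> Cmod (h x) <= / INR n)).
(* A bump is guaranteed only for [z] in [l]; [f] merely witnesses that the type is inhabited. *)
set (H := fun z => epsilon (inhabits f) (ok z)).
assert (HH : forall z, In z l -> ok z (H z)).
{ intros z Hz; apply epsilon_spec; destruct (Hl2 z Hz) as [Uz Gz].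
  apply exists_bump; [exact Hf|apply Hin, Uz|auto|lra|apply Rinv_0_lt_compat, N|lra]. }
apply NNPP; intros Hno.
assert (Hbig : forall z, In z l -> e <= Cmod (xi (H z))).
{ intros z Hz; apply Rnot_lt_le; intros Hlt; apply Hno.
  destruct (Hl2 z Hz) as [Uz Gz], (HH z Hz) as [K1 K2].
  exists z, (H z); repeat split; auto; intros x Hx; apply K2, Hx. }
destruct (functional_abs_sum xi H l Hplus Hscal) as [F [F1 F2]].
assert (NF : sup_norm F <= 5).
{ apply sup_norm_le; intros x Hx; apply Rle_trans with (1 := F2 x).
  apply Rle_trans with (4 + INR (length l) * / INR n); [|rewrite Hl, Rinv_r; lra].
  apply sum_separated_bumps with (b := fun z => phi z) (x := x) (r := r); [lra| | |exact Hsep].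
  - left; apply Rinv_0_lt_compat, N.
  - intros z Hz; apply (HH z Hz); left; exact Hx. }
assert (K := sum_list_ge_const _ l e Hbig); cbv beta in K; rewrite Hl in K.
specialize (Hxi F); rewrite F1, Cmod_R in Hxi.
assert (K2 := Rle_abs (sum_list (fun z => Cmod (xi (H z))) l)).
assert (K3 : B * sup_norm F <= B * 5) by (apply Rmult_le_compat_l; lra).
apply Rmult_lt_compat_l with (r := INR n * (5 * B)) in Hn; [|apply Rmult_lt_0_compat; lra].
replace (INR n * (5 * B) * / INR n) with (5 * B) in Hn by (field; lra).
replace (INR n * (5 * B) * (e / (5 * B))) with (INR n * e) in Hn by (field; lra).
lra.
Qed.

Lemma exists_aligning_phase (a b : C) : a <> 0%C ->
  exists c : C, Cmod c = 1 /\ Cmod (a * c + b) = Cmod a + Cmod b.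
Proof.
intros Ha; destruct (Cmod_unit_phase a) as [s [S1 S2]], (Cmod_unit_phase b) as [t [T1 T2]].
assert (Ht : t <> 0%C) by (apply Cmod_gt_0; lra).
exists (s / t)%C; split; [rewrite Cmod_div, S1, T1 by exact Ht; field|].
rewrite <- (Rmult_1_l (Cmod (a * (s / t) + b))), <- T1, <- Cmod_mult.
replace (t * (a * (s / t) + b))%C with (s * a + t * b)%C by (field; exact Ht).
rewrite S2, T2, <- RtoC_plus, Cmod_R; apply Rabs_pos_eq.
generalize (Cmod_ge_0 a) (Cmod_ge_0 b); lra.
Qed.

(** The test vector is [f + h] with [f] nearly extremal for [T] and [xi h] small. At the peak point
    [z], its image is close to [u z * lambda z + T f z], whose two terms have the same phase. *)
Lemma weighted_comp_op_norm_plus (phi u : disc_algebra) (Hphi : disc_self_map phi) (c0 : R)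
  (T : da_NormedModule -> da_NormedModule) :
  inner phi -> 0 < c0 -> (forall z, unit_circle z -> Cmod (u z) = c0) -> rank_one T ->
  c0 + op_norm T <= op_norm (fun f : da_NormedModule => plus (weighted_comp u phi Hphi f) (T f)).
Proof.
intros Hin Hc0 Hu HT.
set (A := fun f : da_NormedModule => plus (weighted_comp u phi Hphi f) (T f) : da_NormedModule).
assert (HA : is_linear A).
{ exact (is_linear_fun_plus (X := da_NormedModule) (Y := da_NormedModule) _ _
    (weighted_comp_linear u phi Hphi) (proj1 HT)). }
destruct (rank_one_functional T HT) as [y [xi [B [HTxi [Hplus [Hscal [HB Hxi]]]]]]].
change (c0 + op_norm T <= op_norm A).
assert (HK : 0 < op_norm T).
{ destruct HT as [HT [v [Hv Hrange]]].
  destruct (proj2 (Hrange v)) as [f Hf].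
  { exists (RtoC 1); symmetry; apply (scal_one (V := da_ModuleSpace)). }
  assert (Nv : 0 < sup_norm v) by apply (sup_norm_pos _ Hv).
  assert (Nf := sup_norm_ge_0 f).
  assert (K := op_norm_scale T f (sup_norm f + 1) HT ltac:(lra) ltac:(lra)).
  rewrite Hf in K; nra. }
assert (S0 : 0 <= op_norm A).
{ apply Rle_trans with (2 := le_op_norm A zero HA ltac:(rewrite norm_zero; lra)), norm_ge_0. }
(* One share of [op_norm A] comes from the norm [1 + eps] of [f + h]. The 2 counts the loss in
   [|T f z|] and the term [xi h * y z]. *)
apply le_of_le_plus_eps with (c := op_norm A + 2); intros eps' Heps'.
set (eps := Rmin eps' 1).
assert (Heps : 0 < eps <= 1) by (split; [apply Rmin_pos; lra|apply Rmin_r]).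
enough (Hmain : c0 + op_norm T - 2 * eps <= (1 + eps) * op_norm A).
{ assert (eps * (op_norm A + 2) <= eps' * (op_norm A + 2))
    by (apply Rmult_le_compat_r; [lra|apply Rmin_l]).
  lra. }
(* Truncation at 0 gives the nonnegative threshold that the maximum principle argument asks for; [m]
   stays below [op_norm T] by [HK]. *)
set (m := Rmax 0 (op_norm T - eps)).
assert (Hm0 : 0 <= m) by apply Rmax_l.
assert (Hm1 : op_norm T - eps <= m) by apply Rmax_r.
destruct (op_norm_approx (X := da_NormedModule) (Y := da_NormedModule) T m (proj1 HT)) as [f [Hf1 Hf2]];
  [apply Rmax_lub_lt; lra|].
destruct (sup_norm_approx _ _ Hf2) as [z' [Hz' Hgz']].
assert (Y0 := sup_norm_ge_0 y).
assert (Hlambda : forall z, unit_circle z -> exists c, Cmod c = 1 /\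
  Cmod (u z * c + T f z) = Cmod (u z) + Cmod (T f z)).
{ intros z Hz; apply exists_aligning_phase, Cmod_gt_0; rewrite Hu; assumption. }
set (lambda := fun z => epsilon (inhabits (RtoC 0)) (fun c => Cmod c = 1 /\
  Cmod (u z * c + T f z) = Cmod (u z) + Cmod (T f z))).
assert (Hla : forall z, unit_circle z -> Cmod (lambda z) = 1 /\
  Cmod (u z * lambda z + T f z) = Cmod (u z) + Cmod (T f z)).
{ intros z Hz; apply (epsilon_spec _ (fun c => Cmod c = 1 /\
    Cmod (u z * c + T f z) = Cmod (u z) + Cmod (T f z))), Hlambda, Hz. }
destruct (exists_small_bump phi (T f) f xi lambda B m (eps / (sup_norm y + 1)) eps z')
  as [z [h [Hz [Hgz [Hxih [Hh1 Hh2]]]]]]; try assumption.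
{ intros x Hx; apply Rle_trans with (1 := le_sup_norm_closed f x Hx), Hf1. }
{ intros z Hz _; apply Hla, Hz. }
{ apply Rdiv_lt_0_compat; lra. }
assert (Hzc : closed_disc z) by (right; exact Hz).
assert (K1 : sup_norm (A (plus f h)) <= (1 + eps) * op_norm A).
{ apply op_norm_scale; [exact HA|lra|]; apply sup_norm_le; intros x Hx.
  apply Hh2; left; exact Hx. }
apply Rle_trans with (2 := K1), Rle_trans with (2 := le_sup_norm_closed _ z Hzc).
assert (E : A (plus f h) z = (u z * lambda z + T f z + xi h * y z)%C).
{ change (A (plus f h) z) with (u z * (f (phi z) + h (phi z)) + T (plus f h) z)%C.
  rewrite !HTxi, Hplus, Hh1; ring. }
rewrite E.
assert (K2 : Cmod (xi h * y z) <= eps).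
{ rewrite Cmod_mult; assert (K3 := le_sup_norm_closed y z Hzc).
  apply Rle_trans with (eps / (sup_norm y + 1) * (sup_norm y + 1)); [|right; field; lra].
  apply Rmult_le_compat; try apply Cmod_ge_0; lra. }
assert (K3 := Cmod_triangle (u z * lambda z + T f z + xi h * y z) (- (xi h * y z))).
replace (u z * lambda z + T f z + xi h * y z + - (xi h * y z))%C
  with (u z * lambda z + T f z)%C in K3 by ring.
rewrite Cmod_opp, (proj2 (Hla z Hz)), Hu in K3 by exact Hz.
lra.
Qed.

Theorem corollary3p11 :
  forall (phi u : disc_algebra) (Hphi : disc_self_map phi),
    u <> zero ->
    (Daugavet_center (weighted_comp u phi Hphi) <->
     inner phi /\ exists (c : C) (h : disc_algebra), inner h /\ u = scal c h).
Proof.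
intros phi u Hphi Hu; split.
- intros HD; split; [apply (Daugavet_center_inner_symbol phi u Hphi HD Hu)|].
  assert (Nu : 0 < sup_norm u) by apply (sup_norm_pos _ Hu).
  (* Normalizing [u] by its norm gives an inner function, because [|u|] equals that norm on the
     whole circle. *)
  exists (RtoC (sup_norm u)), (scal (RtoC (/ sup_norm u)) u); split.
  + intros z Hz; change (Cmod (RtoC (/ sup_norm u) * u z) = 1).
    rewrite Cmod_mult, (Daugavet_center_Cmod_weight phi u Hphi z HD Hz), Cmod_R, Rabs_pos_eq
      by (left; apply Rinv_0_lt_compat, Nu).
    apply Rinv_l; lra.
  + apply da_eq; intros z.
    change (u z = (RtoC (sup_norm u) * (RtoC (/ sup_norm u) * u z))%C).
    rewrite Cmult_assoc, <- RtoC_mult, Rinv_r, Cmult_1_l by lra; reflexivity.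
- intros [Hin [c [h [Hh Euh]]]].
  assert (Euz : forall z, u z = (c * h z)%C) by (intros z; rewrite Euh; reflexivity).
  assert (Hc : 0 < Cmod c).
  { apply Cmod_gt_0; intros E; apply Hu, da_eq; intros z; rewrite Euz, E.
    change (0 * h z = 0)%C; ring. }
  assert (Hu1 : forall z, unit_circle z -> Cmod (u z) = Cmod c).
  { intros z Hz; rewrite Euz, Cmod_mult, (Hh z Hz); ring. }
  assert (HG := weighted_comp_linear u phi Hphi).
  split; [exact HG|]; intros T HT.
  set (G := weighted_comp u phi Hphi : da_NormedModule -> da_NormedModule) in *.
  (* The constant modulus of [u] on the circle bounds [u] on the disc by the maximum principle. *)
  assert (NG : op_norm G <= Cmod c).
  { apply op_norm_le; intros f Hf; apply sup_norm_le; intros z Hz.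
    change (Cmod (u z * f (phi z)) <= Cmod c); rewrite Cmod_mult, <- (Rmult_1_r (Cmod c)).
    apply Rmult_le_compat; try apply Cmod_ge_0.
    - apply max_modulus; [apply da_holomorphic| |left; exact Hz].
      intros x Hx; rewrite Hu1 by exact Hx; lra.
    - apply Rle_trans with (2 := Hf), le_sup_norm, Hphi, Hz. }
  apply Rle_antisym.
  + apply op_norm_le; intros f Hf.
    apply Rle_trans with (1 := norm_triangle (G f) (T f)).
    apply Rplus_le_compat; apply le_op_norm; auto; apply HT.
  + apply Rle_trans with (Cmod c + op_norm T); [apply Rplus_le_compat_r, NG|].
    apply (weighted_comp_op_norm_plus phi u Hphi (Cmod c) T); assumption.
Qed.
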